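(* Let $\mathcal A$ be a strictly unital $A_\infty$-category. For every pair of objects $A,A'$ of $\mathcal A$, the Yoneda $A_\infty$-functor $y:\mathcal A\to\mathcal C_\infty\mathcal A$ induces an isomorphism $$H^*\mathrm{Hom}_{\mathcal A}(A,A')\xrightarrow{\ \sim\ }H^*\mathrm{Hom}_{\mathcal C_\infty\mathcal A}(A^\wedge,A'^\wedge).$$
   Context: $\mathbb K$ is a field; everything is $\mathbb Z$-graded over $\mathbb K$, with Koszul signs; $(SM)^i=M^{i+1}$, $s:M\to SM$ canonical of degree $-1$, $\omega=s^{-1}$. An $A_\infty$-category $\mathcal A$ on a set $\mathbb A$ of objects: graded spaces $\mathcal A(A,A')$ and maps $m_n:\mathcal A(A_{n-1},A_n)\otimes\cdots\otimes\mathcal A(A_0,A_1)\to\mathcal A(A_0,A_n)$ ($n\ge1$) of degree $2-n$ with $\sum_{j+k+l=n}(-1)^{jk+l}m_{j+1+l}(\mathbf 1^{\otimes j}\otimes m_k\otimes\mathbf 1^{\otimes l})=0$. Put $b_n=-s\,m_n\,\omega^{\otimes n}$. Strictly unital: there are degree $0$ elements $\mathrm{id}_A\in\mathcal A(A,A)$ that are units for $m_2$ and such that $m_n$, $n\ne2$, vanishes if one argument is an identity. $H^*$ of $\mathrm{Hom}_{\mathcal A}(A,A')=\mathcal A(A,A')$ is cohomology for $m_1$. An $\mathcal A$-polydule: graded spaces $M(A)$, $A\in\mathbb A$, and maps $m_i^M:M(A_{i-1})\otimes\mathcal A(A_{i-2},A_{i-1})\otimes\cdots\otimes\mathcal A(A_0,A_1)\to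 M(A_0)$ of degree $2-i$ ($i\ge1$) satisfying the same equations; equivalently, $b_i=-sm_i^M\omega^{\otimes i}$ give a comodule differential on $BM=SM\odot T^c(S\mathcal A)$ (tensor product over $\mathbb A$, $T^c(S\mathcal A)=\bigoplus_{i\ge0}(S\mathcal A)^{\odot i}$). $M$ is strictly unital if $m_2^M(-\otimes\mathrm{id})=\mathrm{id}_M$ and $m_i^M$ ($i\ge3$) vanishes if an $\mathcal A$-argument is an identity. $\mathcal C_\infty\mathcal A$ is the dg category of strictly unital $\mathcal A$-polydules, with $\mathrm{Hom}(M,M')$ the complex of graded comodule maps $F:BM\to BM'$ that are strictly unital (components $F_i$, $i\ge2$, vanish if an $\mathcal A$-argument is the suspension of an identity), with differential $F\mapsto b\circ F-(-1)^{|F|}F\circ b$. For $A\in\mathbb A$, $A^\wedge=\mathcal A(?,A)$ with operations those of $\mathcal A$. Yoneda $A_\infty$-functor $y:\mathcal A\to\mathcal C_\infty\mathcal A$: on objects $A\mapsto A^\wedge$; for $\phi\in S\mathcal A(A_{i-1},A_i)\otimes\cdots\otimes S\mathcal A(A_0,A_1)$ of degree $|\phi|$, the component $Y_i=sy_i\omega^{\otimes i}$ sends $\phi$ to $s\Phi$, where $\Phi:BA_0^\wedge\to BA_i^\wedge$ is the comodule map whose components are $\kappa\otimes\psi\mapsto(-1)^{|\phi|}b_{i+1+j}(\phi\otimes\kappa\otimes\psi)$ for $\kappa\in SA_0^\wedge$, $\psi\in(S\mathcal A)^{\odot j}$, $j\ge0$. The induced map in the claim is the one induced in cohomology by $y_1$.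 *)

(* Defs.v *)
From HB Require Import structures.
From mathcomp Require Import all_boot all_order all_algebra.
From mathcomp Require Import boolp.

Set Implicit Arguments.
Unset Strict Implicit.
Unset Printing Implicit Defensive.

Import GRing.Theory.
Local Open Scope ring_scope.
Local Open Scope quotient_scope.

(** * Vector spaces given by generators and linear relations *)

(* [pres lin] is the vector space spanned by symbols [gen x], for [x : X],
   subject to the relations [gen x = c *: gen x1 + gen x2] for all
   [lin c x x1 x2].  It is built as the quotient of formal linear expressions
   by the congruence generated by the vector space axioms and the relations.
   Tensor products and cohomology spaces are special cases. *)
Section Presentation.
Variables (K : fieldType) (X : Type) (lin : K -> X -> X -> X -> Prop).

Inductive expr : Type :=
  | EGen of X
  | EZero
  | EAdd of expr & expr
  | EScale of K & expr.

Inductive eqv : expr -> expr -> Prop :=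
  | eqv_refl a : eqv a a
  | eqv_sym a b : eqv a b -> eqv b a
  | eqv_trans a b c : eqv a b -> eqv b c -> eqv a c
  | eqv_add a a' b b' : eqv a a' -> eqv b b' -> eqv (EAdd a b) (EAdd a' b')
  | eqv_scale k a a' : eqv a a' -> eqv (EScale k a) (EScale k a')
  | eqv_addA a b c : eqv (EAdd a (EAdd b c)) (EAdd (EAdd a b) c)
  | eqv_addC a b : eqv (EAdd a b) (EAdd b a)
  | eqv_add0 a : eqv (EAdd EZero a) a
  | eqv_addN a : eqv (EAdd (EScale (-1) a) a) EZero
  | eqv_scaleA k l a : eqv (EScale k (EScale l a)) (EScale (k * l) a)
  | eqv_scale1 a : eqv (EScale 1 a) a
  | eqv_scaleDr k a b :
      eqv (EScale k (EAdd a b)) (EAdd (EScale k a) (EScale k b))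
  | eqv_scaleDl k l a :
      eqv (EScale (k + l) a) (EAdd (EScale k a) (EScale l a))
  | eqv_lin c x x1 x2 : lin c x x1 x2 ->
      eqv (EGen x) (EAdd (EScale c (EGen x1)) (EGen x2)).

HB.instance Definition _ := gen_eqMixin expr.
HB.instance Definition _ := gen_choiceMixin expr.

Definition eqvb : rel expr := fun a b => `[< eqv a b >].

Fact eqvb_refl : reflexive eqvb.
Proof. by move=> a; apply/asboolP; apply: eqv_refl. Qed.

Fact eqvb_sym : symmetric eqvb.
Proof. by move=> a b; apply/asboolP/asboolP => h; apply: eqv_sym. Qed.

Fact eqvb_trans : transitive eqvb.
Proof.
move=> b a c /asboolP hab /asboolP hbc; apply/asboolP.
exact: eqv_trans hab hbc.
Qed.

Canonical eqvb_equiv := EquivRel eqvb eqvb_refl eqvb_sym eqvb_trans.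

Definition pres : Type := {eq_quot eqvb}.
HB.instance Definition _ := Choice.on pres.

Definition pres_pi (a : expr) : pres := \pi_({eq_quot eqvb}) a.
Definition pres_repr (x : pres) : expr := repr (x : {eq_quot eqvb}).

Fact pres_piP a b : eqv a b -> pres_pi a = pres_pi b.
Proof. by move=> h; apply/eqquotP; apply/asboolP. Qed.

Fact pres_reprP a : eqv (pres_repr (pres_pi a)) a.
Proof.
have : pres_pi (pres_repr (pres_pi a)) = pres_pi a by exact: reprK.
by move/eqquotP/asboolP.
Qed.

Fact pres_reprK x : pres_pi (pres_repr x) = x.
Proof. exact: reprK. Qed.

Definition pres_zero : pres := pres_pi EZero.
Definition pres_scale k (x : pres) : pres := pres_pi (EScale k (pres_repr x)).
Definition pres_opp (x : pres) : pres := pres_scale (-1) x.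
Definition pres_add (x y : pres) : pres :=
  pres_pi (EAdd (pres_repr x) (pres_repr y)).

Fact pres_piD a b : pres_pi (EAdd a b) = pres_add (pres_pi a) (pres_pi b).
Proof. by apply/esym/pres_piP/eqv_add; apply: pres_reprP. Qed.

Fact pres_piZ k a : pres_pi (EScale k a) = pres_scale k (pres_pi a).
Proof. by apply/esym/pres_piP/eqv_scale; apply: pres_reprP. Qed.

Let piW (P : pres -> Prop) : (forall a, P (pres_pi a)) -> forall x, P x.
Proof. by move=> h x; rewrite -(pres_reprK x). Qed.

Fact pres_addA : associative pres_add.
Proof.
elim/piW=> a; elim/piW=> b; elim/piW=> c.
by rewrite -!pres_piD; apply/pres_piP/eqv_addA.
Qed.

Fact pres_addC : commutative pres_add.
Proof.
by elim/piW=> a; elim/piW=> b; rewrite -!pres_piD; apply/pres_piP/eqv_addC.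
Qed.

Fact pres_add0 : left_id pres_zero pres_add.
Proof. by elim/piW=> a; rewrite -pres_piD; apply/pres_piP/eqv_add0. Qed.

Fact pres_addN : left_inverse pres_zero pres_opp pres_add.
Proof.
by elim/piW=> a; rewrite /pres_opp -pres_piZ -pres_piD; apply/pres_piP/eqv_addN.
Qed.

HB.instance Definition _ :=
  GRing.isZmodule.Build pres pres_addA pres_addC pres_add0 pres_addN.

Let piD a b : pres_pi (EAdd a b) = pres_pi a + pres_pi b.
Proof. exact: pres_piD. Qed.

Fact pres_scaleA k l x : pres_scale k (pres_scale l x) = pres_scale (k * l) x.
Proof.
by elim/piW: x => a; rewrite -!pres_piZ; apply/pres_piP/eqv_scaleA.
Qed.

Fact pres_scale1 : left_id 1 pres_scale.
Proof. by elim/piW=> a; rewrite -pres_piZ; apply/pres_piP/eqv_scale1. Qed.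

Fact pres_scaleDr : right_distributive pres_scale +%R.
Proof.
move=> k; elim/piW=> a; elim/piW=> b.
by rewrite -piD -!pres_piZ -piD; apply/pres_piP/eqv_scaleDr.
Qed.

Fact pres_scaleDl x : {morph pres_scale^~ x : k l / k + l}.
Proof.
elim/piW: x => a k l.
by rewrite -!pres_piZ -piD; apply/pres_piP/eqv_scaleDl.
Qed.

HB.instance Definition _ := GRing.Zmodule_isLmodule.Build K pres
  pres_scaleA pres_scale1 pres_scaleDr pres_scaleDl.

Definition gen (x : X) : pres := pres_pi (EGen x).

Lemma gen_lin c x x1 x2 : lin c x x1 x2 -> gen x = c *: gen x1 + gen x2.
Proof.
by move=> h; rewrite /gen (pres_piP (eqv_lin h)) piD pres_piZ.
Qed.

(* The universal property. *)
Section Lift.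
Variables (V : lmodType K) (f : X -> V).
Hypothesis f_lin :
  forall c x x1 x2, lin c x x1 x2 -> f x = c *: f x1 + f x2.

Fixpoint eval (a : expr) : V :=
  match a with
  | EGen x => f x
  | EZero => 0
  | EAdd a b => eval a + eval b
  | EScale k a => k *: eval a
  end.

Fact eval_eqv a b : eqv a b -> eval a = eval b.
Proof.
elim=> {a b} //=.
- by move=> a b c _ -> _ ->.
- by move=> a a' b b' _ -> _ ->.
- by move=> k a a' _ ->.
- by move=> a b c; rewrite addrA.
- by move=> a b; rewrite addrC.
- by move=> a; rewrite add0r.
- by move=> a; rewrite scaleN1r addNr.
- by move=> k l a; rewrite scalerA.
- by move=> a; rewrite scale1r.
- by move=> k a b; rewrite scalerDr.
- by move=> k l a; rewrite scalerDl.
Qed.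

Definition lift_fun (x : pres) : V := eval (pres_repr x).

Fact lift_fun_pi a : lift_fun (pres_pi a) = eval a.
Proof. exact/eval_eqv/pres_reprP. Qed.

Fact lift_fun_linear : linear lift_fun.
Proof.
move=> k; elim/piW=> a; elim/piW=> b.
have -> : k *: pres_pi a + pres_pi b = pres_pi (EAdd (EScale k a) b).
  by rewrite piD pres_piZ.
by rewrite !lift_fun_pi.
Qed.

HB.instance Definition _ :=
  GRing.isLinear.Build K pres V *:%R lift_fun lift_fun_linear.

Definition lift : {linear pres -> V} := lift_fun.

Lemma lift_gen x : lift (gen x) = f x.
Proof. exact: lift_fun_pi. Qed.

End Lift.

Lemma pres_ind_gen (P : pres -> Prop) :
  (forall x, P (gen x)) -> P 0 ->
  (forall c x y, P x -> P y -> P (c *: x + y)) -> forall x, P x.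
Proof.
move=> hg h0 hl; elim/piW; elim=> // [a ha b hb|k a ha].
- by rewrite piD -[pres_pi a]scale1r; apply: hl.
- by rewrite pres_piZ -[pres_scale _ _]addr0; apply: hl.
Qed.

(* Equality of classes, for relations holding modulo a subspace [B] of a
   product of vector spaces. *)
Lemma gen_eq_mod (J : Type) (V : J -> lmodType K) (f : X -> forall j, V j)
    (B : (forall j, V j) -> Prop) :
  (forall g g', (forall j, g j = g' j) -> B g -> B g') ->
  B (fun=> 0) ->
  (forall c g g', B g -> B g' -> B (fun j => c *: g j + g' j)) ->
  (forall c x x1 x2, lin c x x1 x2 ->
     B (fun j => f x j - (c *: f x1 j + f x2 j))) ->
  forall x y, gen x = gen y -> B (fun j => f x j - f y j).
Proof.
move=> hext h0 hc hf x y /eqquotP/asboolP.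
have hD g g' : B g -> B g' -> B (fun j => g j + g' j).
  by move=> hg hg'; apply: hext (hc 1 _ _ hg hg') => j; rewrite scale1r.
have hZ c g : B g -> B (fun j => c *: g j).
  by move=> hg; apply: hext (hc c _ _ hg h0) => j; rewrite addr0.
have hE g g' : (forall j, g j = g' j) -> B (fun j => g j - g' j).
  by move=> hg; apply: hext h0 => j; rewrite hg subrr.
pose ev a j := eval (fun x => f x j) a.
suff H a b : eqv a b -> B (fun j => ev a j - ev b j) by move/H.
elim=> {a b x y}.
- by move=> a; apply: hE.
- by move=> a b _ /(hZ (-1)); apply: hext => j; rewrite scaleN1r opprB.
- move=> a b c _ h1 _ h2; apply: hext (hD _ _ h1 h2) => j.
  by rewrite addrA subrK.
- move=> a a' b b' _ h1 _ h2; apply: hext (hD _ _ h1 h2) => j.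
  by rewrite /ev /= opprD addrACA.
- by move=> k a a' _ /(hZ k); apply: hext => j; rewrite /ev /= scalerBr.
- by move=> a b c; apply: hE => j; rewrite /ev /= addrA.
- by move=> a b; apply: hE => j; rewrite /ev /= addrC.
- by move=> a; apply: hE => j; rewrite /ev /= add0r.
- by move=> a; apply: hE => j; rewrite /ev /= scaleN1r addNr.
- by move=> k l a; apply: hE => j; rewrite /ev /= scalerA.
- by move=> a; apply: hE => j; rewrite /ev /= scale1r.
- by move=> k a b; apply: hE => j; rewrite /ev /= scalerDr.
- by move=> k l a; apply: hE => j; rewrite /ev /= scalerDl.
- by move=> c x x1 x2 /hf.
Qed.

End Presentation.

(* [otens V W] is the direct sum over [i : I] of the [V i (x) W i]. *)
Section Tensor.
Variables (K : fieldType) (I : Type) (V W : I -> lmodType K).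

Inductive tlin (c : K) : {i : I & (V i * W i)%type} ->
    {i : I & (V i * W i)%type} -> {i : I & (V i * W i)%type} -> Prop :=
  | tlin_l i (x1 x2 : V i) (y : W i) :
      tlin c (existT _ i (c *: x1 + x2, y))
             (existT _ i (x1, y)) (existT _ i (x2, y))
  | tlin_r i (x : V i) (y1 y2 : W i) :
      tlin c (existT _ i (x, c *: y1 + y2))
             (existT _ i (x, y1)) (existT _ i (x, y2)).

Definition otens : lmodType K := pres tlin.

Definition tens i (x : V i) (y : W i) : otens :=
  gen tlin (existT _ i (x, y)).

Lemma tens_linl i c (x1 x2 : V i) (y : W i) :
  tens (c *: x1 + x2) y = c *: tens x1 y + tens x2 y.
Proof. exact/gen_lin/tlin_l. Qed.

Lemma tens_linr i c (x : V i) (y1 y2 : W i) :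
  tens x (c *: y1 + y2) = c *: tens x y1 + tens x y2.
Proof. exact/gen_lin/tlin_r. Qed.

End Tensor.

(* [F (x) 1] *)
Section TensorMap.
Variables (K : fieldType) (I : Type) (V V' W : I -> lmodType K).
Variable F : forall i, {linear V i -> V' i}.

Definition tmapl_gen (u : {i : I & (V i * W i)%type}) : otens V' W :=
  tens (F (tag u) (tagged u).1) (tagged u).2.

Fact tmapl_lin c u u1 u2 : tlin c u u1 u2 ->
  tmapl_gen u = c *: tmapl_gen u1 + tmapl_gen u2.
Proof.
case=> {u u1 u2} i; rewrite /tmapl_gen /= => x y z.
- by rewrite linearP tens_linl.
- by rewrite tens_linr.
Qed.

Definition tmapl : {linear otens V W -> otens V' W} := lift tmapl_lin.

End TensorMap.

Arguments tmapl {K I V V'} W F.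

Lemma tmapl_comb (K : fieldType) (I : Type) (V V' W : I -> lmodType K) c
    (F G H : forall i, {linear V i -> V' i}) :
  (forall i x, H i x = c *: F i x + G i x) ->
  forall u : otens V W, tmapl W H u = c *: tmapl W F u + tmapl W G u.
Proof.
move=> hH; elim/pres_ind_gen => [[i [x y]]||k u v hu hv].
- by rewrite /tmapl !lift_gen /tmapl_gen /= hH tens_linl.
- by rewrite !linear0 addr0.
- rewrite [tmapl W H _]linearP [tmapl W F _]linearP [tmapl W G _]linearP hu hv !scalerDr !scalerA [c * k]mulrC.
  by rewrite -!addrA; congr (_ + _); rewrite addrCA.
Qed.

(** * Words *)

Definition sgn (K : fieldType) (i : int) : K := (-1) ^ i.

Definition susp (K : fieldType) (V : int -> lmodType K) : int -> lmodType K :=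
  fun n => V (n + 1).

Section Words.
Variables (K : fieldType) (Ob : Type).

Definition gquiver := Ob -> Ob -> int -> lmodType K.
Definition gspaces := Ob -> int -> lmodType K.

Section Paths.
Variable Q : gquiver.

(* A [path Q A0 An] is a word [a_n, ..., a_1] of homogeneous elements, where
   [a_i] lies in [Q A_(i-1) A_i] and the letters are written from left to right
   as in [Q A_(n-1) A_n (x) ... (x) Q A_0 A_1]. *)
Inductive path (A : Ob) : Ob -> Type :=
  | pnil : path A A
  | pcons (B C : Ob) (p : int) (a : Q B C p) (w : path A B) : path A C.

Fixpoint plen A B (w : path A B) : nat :=
  if w is pcons _ _ _ _ w' then (plen w').+1 else 0%N.

Fixpoint pdeg A B (w : path A B) : int :=
  if w is pcons _ _ p _ w' then p + pdeg w' else 0.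

Fixpoint pcat A B C (u : path B C) : path A B -> path A C :=
  match u in path _ C0 return path A B -> path A C0 with
  | pnil => fun w => w
  | pcons _ _ _ a u' => fun w => pcons a (pcat u' w)
  end.

(* [pcomb c w w1 w2]: the three words agree except for one letter, where the
   letter of [w] is [c *: a1 + a2] if those of [w1], [w2] are [a1], [a2]. *)
Inductive pcomb (c : K) (A : Ob) :
    forall B, path A B -> path A B -> path A B -> Prop :=
  | pcomb_here B C p (a1 a2 : Q B C p) (w : path A B) :
      pcomb c (pcons (c *: a1 + a2) w) (pcons a1 w) (pcons a2 w)
  | pcomb_there B C p (a : Q B C p) (w w1 w2 : path A B) :
      pcomb c w w1 w2 -> pcomb c (pcons a w) (pcons a w1) (pcons a w2).

(* The sum of the [G v t] over all ways of writing [w] as [pcat v t]. *)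
Fixpoint splitsum (V : zmodType) A B (w : path A B) :
    (forall C, path C B -> path A C -> V) -> V :=
  match w in path _ B0 return (forall C, path C B0 -> path A C -> V) -> V with
  | pnil => fun G => G A (pnil A) (pnil A)
  | pcons B' C' p a w' => fun G =>
      G C' (pnil C') (pcons a w')
      + splitsum w' (fun D v t => G D (pcons a v) t)
  end.

Lemma pcomb_len c A B (w w1 w2 : path A B) :
  pcomb c w w1 w2 -> (plen w = plen w1) * (plen w = plen w2).
Proof. by elim=> {B w w1 w2} //= B C p a w w1 w2 _ [<- <-]. Qed.

Lemma pcomb_deg c A B (w w1 w2 : path A B) :
  pcomb c w w1 w2 -> (pdeg w = pdeg w1) * (pdeg w = pdeg w2).
Proof. by elim=> {B w w1 w2} //= B C p a w w1 w2 _ [<- <-]. Qed.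

Lemma pcomb_catl c A B C (u u1 u2 : path B C) (w : path A B) :
  pcomb c u u1 u2 -> pcomb c (pcat u w) (pcat u1 w) (pcat u2 w).
Proof.
by elim=> {C u u1 u2} *; [apply: pcomb_here | apply: pcomb_there].
Qed.

Lemma pcomb_catr c A B C (u : path B C) (w w1 w2 : path A B) :
  pcomb c w w1 w2 -> pcomb c (pcat u w) (pcat u w1) (pcat u w2).
Proof. by move=> h; elim: u => //= *; apply: pcomb_there. Qed.

Lemma splitsum_comb (V : lmodType K) c A B (w : path A B)
    (G G1 G2 : forall C, path C B -> path A C -> V) :
  (forall C v t, G C v t = c *: G1 C v t + G2 C v t) ->
  splitsum w G = c *: splitsum w G1 + splitsum w G2.
Proof.
elim: w G G1 G2 => /= [|B' C' p a w IH] G G1 G2 h; first exact: h.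
rewrite h (IH _ (fun D v t => G1 D (pcons a v) t)
               (fun D v t => G2 D (pcons a v) t)); last by move=> *; apply: h.
by rewrite scalerDr addrACA.
Qed.

Lemma splitsum_ext (V : zmodType) A B (w : path A B)
    (G G' : forall C, path C B -> path A C -> V) :
  (forall C v t, G C v t = G' C v t) -> splitsum w G = splitsum w G'.
Proof.
elim: w G G' => /= [|B' C' p a w IH] G G' h; first exact: h.
by rewrite h; congr (_ + _); apply: IH => *; apply: h.
Qed.

Definition bilin (V : lmodType K) A B
    (G : forall C, path C B -> path A C -> V) : Prop :=
  (forall c C v v1 v2 t, pcomb c v v1 v2 ->
     G C v t = c *: G C v1 t + G C v2 t) /\
  (forall c C v t t1 t2, pcomb c t t1 t2 ->
     G C v t = c *: G C v t1 + G C v t2).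

Lemma splitsum_lin (V : lmodType K) c A B (w w1 w2 : path A B)
    (G : forall C, path C B -> path A C -> V) :
  bilin G -> pcomb c w w1 w2 ->
  splitsum w G = c *: splitsum w1 G + splitsum w2 G.
Proof.
move=> [hl hr] h; elim: h G hl hr => {B w w1 w2} /=.
- move=> B C p a1 a2 w G hl hr.
  rewrite (hr c _ _ _ (pcons a1 w) (pcons a2 w)); last exact: pcomb_here.
  rewrite (@splitsum_comb _ c _ _ w _ (fun D v t => G D (pcons a1 v) t)
               (fun D v t => G D (pcons a2 v) t)); first last.
    by move=> D v t; apply: hl; apply: pcomb_here.
  by rewrite scalerDr addrACA.
- move=> B C p a w w1 w2 h IH G hl hr.
  rewrite (hr c _ _ _ (pcons a w1) (pcons a w2)); last exact: pcomb_there.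
  rewrite IH; first by rewrite scalerDr addrACA.
  + by move=> c' D v v1 v2 t hv; apply: hl; apply: pcomb_there.
  + by move=> c' D v t t1 t2 ht; apply: hr.
Qed.

End Paths.

(* Words [x, a_(i-1), ..., a_1] in [M A_(i-1) (x) Q A_(i-2) A_(i-1) (x) ...
   (x) Q A_0 A_1], where [A = A_0]. *)
Section ModuleWords.
Variables (M : gspaces) (Q : gquiver).

Inductive mword (A : Ob) : Type :=
  MWord C p (x : M C p) (w : path Q A C).

Definition mlen A (g : mword A) : nat :=
  let: MWord _ _ _ w := g in (plen w).+1.
Definition mdeg A (g : mword A) : int :=
  let: MWord _ p _ w := g in p + pdeg w.

Inductive mcomb (c : K) A : mword A -> mword A -> mword A -> Prop :=
  | mcomb_head C p (x1 x2 : M C p) (w : path Q A C) :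
      mcomb c (MWord (c *: x1 + x2) w) (MWord x1 w) (MWord x2 w)
  | mcomb_tail C p (x : M C p) (w w1 w2 : path Q A C) :
      pcomb c w w1 w2 -> mcomb c (MWord x w) (MWord x w1) (MWord x w2).

Lemma mcomb_len c A (g g1 g2 : mword A) :
  mcomb c g g1 g2 -> (mlen g = mlen g1) * (mlen g = mlen g2).
Proof. by case=> //= C p x w w1 w2 /pcomb_len[<- <-]. Qed.

Lemma mcomb_deg c A (g g1 g2 : mword A) :
  mcomb c g g1 g2 -> (mdeg g = mdeg g1) * (mdeg g = mdeg g2).
Proof. by case=> //= C p x w w1 w2 /pcomb_deg[<- <-]. Qed.

End ModuleWords.

(* The tensor coalgebra [T^c Q] and the cofree comodule [M (.) T^c Q]: linear
   combinations of words, modulo multilinearity.  The grading is internal: the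
   homogeneous parts are spanned by the words of a given degree. *)
Definition Tc (Q : gquiver) (A B : Ob) : lmodType K :=
  pres (fun c (w w1 w2 : path Q A B) => pcomb c w w1 w2).

Definition cofree (M : gspaces) (Q : gquiver) (A : Ob) : lmodType K :=
  pres (fun c (g g1 g2 : mword M Q A) => mcomb c g g1 g2).

Definition pword (Q : gquiver) A B (w : path Q A B) : Tc Q A B := gen _ w.
Definition cword M (Q : gquiver) A (g : mword M Q A) : cofree M Q A := gen _ g.

Lemma pword_lin Q A B c (w w1 w2 : path Q A B) :
  pcomb c w w1 w2 -> pword w = c *: pword w1 + pword w2.
Proof. by move=> h; apply: gen_lin. Qed.

Lemma cword_lin M Q A c (g g1 g2 : mword M Q A) :
  mcomb c g g1 g2 -> cword g = c *: cword g1 + cword g2.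
Proof. by move=> h; apply: gen_lin. Qed.

Inductive homog M Q A (n : int) : cofree M Q A -> Prop :=
  | homog_word g : mdeg g = n -> homog n (cword g)
  | homog0 : homog n 0
  | homog_lin c x y : homog n x -> homog n y -> homog n (c *: x + y).

(* The coaction [cofree M Q -> cofree M Q (.) T^c Q]: deconcatenation. *)
Section Coaction.
Variables (M : gspaces) (Q : gquiver) (A : Ob).

Definition cotensor : lmodType K :=
  otens (fun C : Ob => cofree M Q C) (fun C : Ob => Tc Q A C).

Definition coact_word (g : mword M Q A) : cotensor :=
  let: MWord _ _ x w := g in
  splitsum w (fun C v t =>
    @tens K Ob (fun C => cofree M Q C) (fun C => Tc Q A C) C
      (cword (MWord x v)) (pword t)).

Fact coact_word_lin c g g1 g2 : mcomb c g g1 g2 ->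
  coact_word g = c *: coact_word g1 + coact_word g2.
Proof.
case=> {g g1 g2} C p.
- move=> x1 x2 w; apply: splitsum_comb => D v t.
  by rewrite (cword_lin (mcomb_head c x1 x2 v)) tens_linl.
- move=> x w w1 w2 h; apply: splitsum_lin h; split.
  + move=> c' D v v1 v2 t hv.
    by rewrite (cword_lin (mcomb_tail x hv)) tens_linl.
  + by move=> c' D v t t1 t2 ht; rewrite (pword_lin ht) tens_linr.
Qed.

Definition coact : {linear cofree M Q A -> cotensor} := lift coact_word_lin.

End Coaction.

(* [cast n x] is the component in degree [n] of a homogeneous element [x]. *)
Definition cast (V : int -> lmodType K) p n (x : V p) : V n :=
  match p =P n with
  | ReflectT e => eq_rect p (fun q => V q) x n e
  | ReflectF _ => 0
  end.

Fact cast_lin (V : int -> lmodType K) p n c (x y : V p) :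
  cast n (c *: x + y) = c *: cast n x + cast n y.
Proof.
rewrite /cast; case: (p =P n) => [e|_]; last by rewrite scaler0 addr0.
by case: _ / e.
Qed.

(* The projection [cofree M Q -> M] onto words of length one, in degree [n]. *)
Section Corestriction.
Variables (M : gspaces) (Q : gquiver) (A : Ob) (n : int).

Definition cores_word (g : mword M Q A) : M A n :=
  let: MWord C p x w := g in
  match w in path _ _ C0 return M C0 p -> M A n with
  | pnil => fun x => cast n x
  | pcons _ _ _ _ _ => fun=> 0
  end x.

Fact cores_word_lin c g g1 g2 : mcomb c g g1 g2 ->
  cores_word g = c *: cores_word g1 + cores_word g2.
Proof.
case=> {g g1 g2} C p.
- move=> x1 x2 w /=; case: w x1 x2 => [|B D q a w] x1 x2; first exact: cast_lin.
  by rewrite scaler0 addr0.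
- move=> x w w1 w2 h /=; case: h x => *; by rewrite scaler0 addr0.
Qed.

Definition cores : {linear cofree M Q A -> M A n} := lift cores_word_lin.

End Corestriction.

Definition suspq (Q : gquiver) : gquiver := fun A B => susp (Q A B).
Definition suspm (M : gspaces) : gspaces := fun A => susp (M A).

(* Removing the suspensions from all letters; [omega_exp] is the exponent of
   the Koszul sign in [omega^(x)n (sa_n, ..., sa_1) = +-(a_n, ..., a_1)]. *)
Fixpoint pdesusp Q A B (w : path (suspq Q) A B) : path Q A B :=
  match w with
  | pnil => pnil Q A
  | pcons B C p a w' => @pcons Q A B C (p + 1) a (pdesusp w')
  end.

Definition mdesusp M Q A (g : mword (suspm M) (suspq Q) A) : mword M Q A :=
  let: MWord C p x w := g in @MWord M Q A C (p + 1) x (pdesusp w).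

Fixpoint omega_exp Q A B (w : path Q A B) : int :=
  if w is pcons _ _ p _ w' then (plen w')%:Z * p + omega_exp w' else 0.

Definition momega_exp M Q A (g : mword M Q A) : int :=
  let: MWord _ p _ w := g in (plen w)%:Z * p + omega_exp w.

Lemma pdesusp_comb Q c A B (w w1 w2 : path (suspq Q) A B) :
  pcomb c w w1 w2 -> pcomb c (pdesusp w) (pdesusp w1) (pdesusp w2).
Proof.
elim=> {B w w1 w2} [B C p a1 a2 w|B C p a w w1 w2 _ IH] /=.
  exact: (@pcomb_here Q c A B C (p + 1) a1 a2).
exact: pcomb_there.
Qed.

Lemma mdesusp_comb M Q c A (g g1 g2 : mword (suspm M) (suspq Q) A) :
  mcomb c g g1 g2 -> mcomb c (mdesusp g) (mdesusp g1) (mdesusp g2).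
Proof.
case=> [C p x1 x2 w|C p x w w1 w2 h] /=.
  exact: (@mcomb_head M Q c A C (p + 1) x1 x2).
exact/mcomb_tail/pdesusp_comb.
Qed.

Lemma omega_exp_comb Q c A B (w w1 w2 : path Q A B) : pcomb c w w1 w2 ->
  (omega_exp w = omega_exp w1) * (omega_exp w = omega_exp w2).
Proof.
elim=> {B w w1 w2} //= B C p a w w1 w2 h [<- <-].
by rewrite -!(pcomb_len h).
Qed.

Lemma momega_exp_comb M Q c A (g g1 g2 : mword M Q A) : mcomb c g g1 g2 ->
  (momega_exp g = momega_exp g1) * (momega_exp g = momega_exp g2).
Proof.
case=> //= C p x w w1 w2 h.
by rewrite -!(omega_exp_comb h) -!(pcomb_len h).
Qed.

End Words.

Arguments pnil {K Ob Q} A.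
Arguments coact {K Ob M Q A}.
Arguments cores {K Ob M Q A} n.

(** * A-infinity categories and polydules *)

Section AInfinity.
Variables (K : fieldType) (Ob : Type).

(* [op w n] is the component in degree [n] of [m_k(w)], where [k = plen w].  In
   [ainf_eq] the word is written as [u v t] with [j = plen u], [k = plen v] and
   [l = plen t]; besides [(-1)^(jk+l)], the sign contains the Koszul sign
   [(-1)^((2-k)|u|)] of [1^(x)j (x) m_k (x) 1^(x)l].  The terms with [k = 0]
   vanish by [op0]. *)
Record ainf_category := AinfCategory {
  hom : gquiver K Ob;
  op : forall A B, path hom A B -> forall n, hom A B n;
  op_deg : forall A B (w : path hom A B) n,
    n != pdeg w + 2 - (plen w)%:Z -> op w n = 0;
  op_lin : forall A B c (w w1 w2 : path hom A B), pcomb c w w1 w2 ->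
    forall n, op w n = c *: op w1 n + op w2 n;
  op0 : forall A n, op (pnil A) n = 0;
  ainf_eq : forall A B (w : path hom A B) n,
    splitsum w (fun C u r => splitsum r (fun D v t =>
      sgn K ((plen u)%:Z * (plen v)%:Z + (plen t)%:Z
             + (2 - (plen v)%:Z) * pdeg u)
      *: op (pcat u (pcons (op v (pdeg v + 2 - (plen v)%:Z)) t)) n)) = 0
}.

Variable A : ainf_category.

Lemma op_letter0 X Y Z p (w : path (hom A) X Y) n :
  op (pcons (0 : hom A Y Z p) w) n = 0.
Proof.
have := op_lin (pcomb_here 1 (0 : hom A Y Z p) 0 w) n.
rewrite scaler0 addr0 scale1r => /esym/eqP.
by rewrite -subr_eq0 addrK => /eqP.
Qed.

Inductive has_unit (e : forall X, hom A X X 0) (X : Ob) :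
    forall Y, path (hom A) X Y -> Prop :=
  | has_unit_here Y (w : path (hom A) X Y) : has_unit e (pcons (e Y) w)
  | has_unit_there Y Z p (a : hom A Y Z p) (w : path (hom A) X Y) :
      has_unit e w -> has_unit e (pcons a w).

Record strict_units := StrictUnits {
  idm : forall X, hom A X X 0;
  op2_idl : forall X Y p (a : hom A X Y p),
    op (pcons (idm Y) (pcons a (pnil X))) p = a;
  op2_idr : forall X Y p (a : hom A X Y p),
    op (pcons a (pcons (idm X) (pnil X))) p = a;
  op_id : forall X Y (w : path (hom A) X Y) n,
    plen w != 2%N -> has_unit idm w -> op w n = 0
}.

(* [b_k = - s m_k omega^(x)k] *)
Definition bop X Y (w : path (suspq (hom A)) X Y) n : suspq (hom A) X Y n :=
  - (sgn K (omega_exp w) *: op (pdesusp w) (n + 1)).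

Lemma bop_lin X Y c (w w1 w2 : path (suspq (hom A)) X Y) : pcomb c w w1 w2 ->
  forall n, bop w n = c *: bop w1 n + bop w2 n.
Proof.
move=> h n; rewrite /bop (op_lin (pdesusp_comb h)) -!(omega_exp_comb h).
by rewrite scalerDr opprD !scalerN !scalerA [c * _]mulrC.
Qed.

(* In [mod_eq] the first sum collects the terms with [j = 0], in which the inner
   operation involves the module element; in the second one [j = plen u + 1]. *)
Record polydule := Polydule {
  mspace : gspaces K Ob;
  mop : forall X, mword mspace (hom A) X -> forall n, mspace X n;
  mop_deg : forall X (g : mword mspace (hom A) X) n,
    n != mdeg g + 2 - (mlen g)%:Z -> mop g n = 0;
  mop_lin : forall X c (g g1 g2 : mword mspace (hom A) X), mcomb c g g1 g2 ->
    forall n, mop g n = c *: mop g1 n + mop g2 n;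
  mod_eq : forall X Y p (x : mspace Y p) (w : path (hom A) X Y) n,
    splitsum w (fun C v t =>
      sgn K (plen t)%:Z
      *: mop (MWord (mop (MWord x v) (p + pdeg v + 2 - (plen v).+1%:Z)) t) n)
    + splitsum w (fun C u r => splitsum r (fun D v t =>
      sgn K ((plen u).+1%:Z * (plen v)%:Z + (plen t)%:Z
             + (2 - (plen v)%:Z) * (p + pdeg u))
      *: mop (MWord x (pcat u (pcons (op v (pdeg v + 2 - (plen v)%:Z)) t))) n))
    = 0
}.

Variable e : strict_units.

Record su_polydule := SUPolydule {
  su_mod :> polydule;
  mop2_id : forall X p (x : mspace su_mod X p),
    mop (MWord x (pcons (idm e X) (pnil X))) p = x;
  mop_id : forall X (g : mword (mspace su_mod) (hom A) X) n,
    (3 <= mlen g)%N ->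
    (let: MWord _ _ _ w := g in has_unit (idm e) w) -> mop g n = 0
}.

(** * The bar construction and the dg category of polydules *)

Definition Bar (M : polydule) (X : Ob) : lmodType K :=
  cofree (suspm (mspace M)) (suspq (hom A)) X.

Definition bword (M : polydule) X
    (g : mword (suspm (mspace M)) (suspq (hom A)) X) : Bar M X := cword g.

Definition bmop (M : polydule) X
    (g : mword (suspm (mspace M)) (suspq (hom A)) X) n : suspm (mspace M) X n :=
  - (sgn K (momega_exp g) *: mop (mdesusp g) (n + 1)).

Lemma bmop_lin M X c (g g1 g2 : mword (suspm (mspace M)) (suspq (hom A)) X) :
  mcomb c g g1 g2 -> forall n, bmop g n = c *: bmop g1 n + bmop g2 n.
Proof.
move=> h n; rewrite /bmop (mop_lin (mdesusp_comb h)) -!(momega_exp_comb h).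
by rewrite scalerDr opprD !scalerN !scalerA [c * _]mulrC.
Qed.

(* The differential [sum 1^(x)j (x) b_k (x) 1^(x)l] of the bar construction. *)
Section BarDifferential.
Variables (M : polydule) (X : Ob).

Definition bar_d_word (g : mword (suspm (mspace M)) (suspq (hom A)) X) :
    Bar M X :=
  let: MWord Y p x w := g in
  splitsum w (fun C v t =>
    bword (MWord (bmop (MWord x v) (p + pdeg v + 1)) t))
  + splitsum w (fun C u r => splitsum r (fun D v t =>
    sgn K (p + pdeg u)
    *: bword (MWord x (pcat u (pcons (bop v (pdeg v + 1)) t))))).

Fact bar_d_word_lin c g g1 g2 : mcomb c g g1 g2 ->
  bar_d_word g = c *: bar_d_word g1 + bar_d_word g2.
Proof.
have scaleC (V : lmodType K) (s k : K) (y z : V) :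
    s *: (k *: y + z) = k *: (s *: y) + s *: z.
  by rewrite scalerDr !scalerA mulrC.
case=> {g g1 g2} Y p.
- move=> x1 x2 w; rewrite /bar_d_word scalerDr addrACA; congr (_ + _).
  + apply: splitsum_comb => D v t.
    rewrite (bmop_lin (mcomb_head c x1 x2 v)).
    exact/cword_lin/mcomb_head.
  + apply: splitsum_comb => C u r; apply: splitsum_comb => D v t.
    by rewrite -scaleC; congr (_ *: _); apply/cword_lin/mcomb_head.
- move=> x w w1 w2 h; rewrite /bar_d_word scalerDr addrACA; congr (_ + _).
  + apply: splitsum_lin h; split.
    * move=> k D v v1 v2 t hv.
      rewrite -!(pcomb_deg hv) (bmop_lin (mcomb_tail x hv)).
      exact/cword_lin/mcomb_head.
    * by move=> k D v t t1 t2 ht; apply/cword_lin/mcomb_tail.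
  + apply: splitsum_lin h; split.
    * move=> k C u u1 u2 r hu; apply: splitsum_comb => D v t.
      rewrite -!(pcomb_deg hu) -scaleC; congr (_ *: _).
      exact/cword_lin/mcomb_tail/pcomb_catl.
    * move=> k C u r r1 r2 hr; apply: splitsum_lin hr; split.
      - move=> k' D v v1 v2 t hv; rewrite -!(pcomb_deg hv) -scaleC.
        congr (_ *: _); rewrite (bop_lin hv).
        exact/cword_lin/mcomb_tail/pcomb_catr/pcomb_here.
      - move=> k' D v t t1 t2 ht; rewrite -scaleC; congr (_ *: _).
        exact/cword_lin/mcomb_tail/pcomb_catr/pcomb_there.
Qed.

Definition bar_d : {linear Bar M X -> Bar M X} := lift bar_d_word_lin.

End BarDifferential.

(* Degree [d] part of the morphism spaces of the category of strictly unital
   polydules: graded comodule maps [Bar M -> Bar N], strictly unital. *)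
Record Hom (M N : su_polydule) (d : int) := MkHom {
  hom_map :> forall X, {linear Bar M X -> Bar N X};
  hom_deg : forall X n (x : Bar M X), homog n x -> homog (n + d) (hom_map X x);
  hom_comod : forall X (x : Bar M X),
    coact (hom_map X x)
    = tmapl (fun C => Tc (suspq (hom A)) X C) hom_map (coact x);
  hom_unital : forall X Y p (x : suspm (mspace M) Y p)
      (w : path (suspq (hom A)) X Y) n,
    has_unit (idm e) (pdesusp w) -> cores n (hom_map X (bword (MWord x w))) = 0
}.

Definition dHom (M N : su_polydule) d (F : Hom M N d) X (x : Bar M X) :
    Bar N X :=
  bar_d N X (F X x) - sgn K d *: F X (bar_d M X x).

Section HomComb.
Variables (M N : su_polydule) (d : int).

Lemma dHom_comb c (F G H : Hom M N d) :
  (forall X x, H X x = c *: F X x + G X x) ->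
  forall X x, dHom H x = c *: dHom F x + dHom (X := X) G x.
Proof.
move=> hH X x; rewrite /dHom !hH linearP scalerBr scalerDr opprD addrACA.
by rewrite !scalerA [c * _]mulrC.
Qed.

Variables (c : K) (F G : Hom M N d).

Let f X : {linear Bar M X -> Bar N X} := (c \*: F X) \+ G X.

Fact hom_comb_deg X n (x : Bar M X) : homog n x -> homog (n + d) (f X x).
Proof. by move=> hx; apply: homog_lin; apply: hom_deg. Qed.

Fact hom_comb_comod X (x : Bar M X) :
  coact (f X x) = tmapl (fun C => Tc (suspq (hom A)) X C) f (coact x).
Proof.
rewrite (tmapl_comb (F := F) (G := G) (c := c)) // -!hom_comod.
exact: linearP.
Qed.

Fact hom_comb_unital X Y p (x : suspm (mspace M) Y p)
    (w : path (suspq (hom A)) X Y) n :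
  has_unit (idm e) (pdesusp w) -> cores n (f X (bword (MWord x w))) = 0.
Proof.
move=> hw; transitivity (c *: cores n (F X (bword (MWord x w)))
                         + cores n (G X (bword (MWord x w)))).
  exact: linearP.
by rewrite !hom_unital // scaler0 addr0.
Qed.

Definition hom_comb := MkHom hom_comb_deg hom_comb_comod hom_comb_unital.

End HomComb.

Section HomZero.
Variables (M N : su_polydule) (d : int).

Let f X : {linear Bar M X -> Bar N X} := \0.

Fact hom0_deg X n (x : Bar M X) : homog n x -> homog (n + d) (f X x).
Proof. by move=> _; apply: homog0. Qed.

Fact hom0_comod X (x : Bar M X) :
  coact (f X x) = tmapl (fun C => Tc (suspq (hom A)) X C) f (coact x).
Proof.
rewrite (tmapl_comb (F := f) (G := f) (c := -1)); last first.
  by move=> C y; rewrite /f /= scaler0 addr0.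
by rewrite scaleN1r addNr; apply: linear0.
Qed.

Fact hom0_unital X Y p (x : suspm (mspace M) Y p)
    (w : path (suspq (hom A)) X Y) n :
  has_unit (idm e) (pdesusp w) -> cores n (f X (bword (MWord x w))) = 0.
Proof. by move=> _; apply: linear0. Qed.

Definition hom0 : Hom M N d := MkHom hom0_deg hom0_comod hom0_unital.

Lemma dHom0 X (x : Bar M X) : dHom hom0 x = 0.
Proof.
have -> : dHom hom0 x = bar_d N X 0 - sgn K d *: 0 by [].
by rewrite scaler0 subr0 linear0.
Qed.

End HomZero.

(** * Cohomology *)

(* In both cases below, cocycles of degree [n] modulo coboundaries of elements
   of degree [n - 1]: the relations of the presentation say that taking the
   class of a cocycle is linear and that cohomologous cocycles have the same
   class.  By [cclassP] and [HclassP], nothing else is identified. *)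
Definition m1 X Y p (f : hom A X Y p) n : hom A X Y n :=
  op (pcons f (pnil X)) n.

Record cocycle X Y n := MkCocycle {
  cocycle_val :> hom A X Y n;
  cocycleP : m1 cocycle_val (n + 1) = 0
}.

Definition cohom X Y n : lmodType K :=
  pres (fun c (f f1 f2 : cocycle X Y n) => exists g : hom A X Y (n - 1),
    (f : hom A X Y n)
    = c *: (f1 : hom A X Y n) + (f2 : hom A X Y n) + m1 g n).

Definition cclass X Y n (f : cocycle X Y n) : cohom X Y n := gen _ f.

Lemma m1_lin X Y p n c (f g : hom A X Y p) :
  m1 (c *: f + g) n = c *: m1 f n + m1 g n.
Proof. exact/op_lin/pcomb_here. Qed.

Lemma cclassP X Y n (f g : cocycle X Y n) :
  cclass f = cclass g <->
  exists k : hom A X Y (n - 1), (f : hom A X Y n) = m1 k n + (g : hom A X Y n).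
Proof.
have m10 p q : m1 (0 : hom A X Y p) q = 0 by exact: op_letter0.
have z0 : m1 (0 : hom A X Y n) (n + 1) = 0 by [].
split=> [h|[k hk]].
- have := @gen_eq_mod _ _ _ unit (fun=> hom A X Y n)
    (fun (f : cocycle X Y n) _ => f : hom A X Y n)
    (fun v => exists k : hom A X Y (n - 1), v tt = m1 k n) _ _ _ _ f g h.
  case.
  + by move=> v v' hv [k hk]; exists k; rewrite -hv.
  + by exists 0; rewrite m10.
  + by move=> c v v' [k ->] [k' ->]; exists (c *: k + k'); rewrite m1_lin.
  + by move=> c x x1 x2 [k ->]; exists k; rewrite [_ + m1 k n]addrC addrK.
  + by move=> k /eqP; rewrite subr_eq => /eqP; exists k.
- pose z := MkCocycle z0.
  have hz : cclass z = 0.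
    have : cclass z = 1 *: cclass z + cclass z.
      apply: gen_lin; exists 0; rewrite m10 /= scaler0 !addr0.
      by [].
    rewrite scale1r => /eqP; rewrite -subr_eq0 opprD addrA subrr sub0r oppr_eq0.
    by move/eqP.
  have -> : cclass f = 0 *: cclass z + cclass g.
    by apply: gen_lin; exists k; rewrite scale0r add0r hk addrC.
  by rewrite scale0r add0r.
Qed.

Record Hcocycle (M N : su_polydule) n := MkHcocycle {
  Hcocycle_val :> Hom M N n;
  HcocycleP : forall X (x : Bar M X), dHom Hcocycle_val x = 0
}.

Definition Hcohom (M N : su_polydule) n : lmodType K :=
  pres (fun c (F F1 F2 : Hcocycle M N n) => exists G : Hom M N (n - 1),
    forall X (x : Bar M X), F X x = c *: F1 X x + F2 X x + dHom G x).

Definition Hclass M N n (F : Hcocycle M N n) : Hcohom M N n := gen _ F.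

Lemma HclassP M N n (F F' : Hcocycle M N n) :
  Hclass F = Hclass F' <->
  exists G : Hom M N (n - 1),
    forall X (x : Bar M X), F X x = dHom G x + F' X x.
Proof.
split=> [h|[G hG]].
- have := @gen_eq_mod _ _ _ {X : Ob & Bar M X} (fun j => Bar N (tag j))
    (fun (F : Hcocycle M N n) j => F (tag j) (tagged j))
    (fun v => exists G : Hom M N (n - 1), forall j, v j = dHom G (tagged j))
    _ _ _ _ F F' h.
  case.
  + by move=> v v' hv [G hG]; exists G => j; rewrite -hv.
  + by exists (hom0 M N (n - 1)) => j; rewrite dHom0.
  + move=> c v v' [G hG] [G' hG']; exists (hom_comb c G G') => j.
    by rewrite (dHom_comb (c := c) (F := G) (G := G')) // hG hG'.
  + move=> c x x1 x2 [G hG]; exists G => j.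
    by rewrite hG [_ + dHom _ _]addrC addrK.
  + move=> G hG; exists G => X x; apply/eqP; rewrite -subr_eq; apply/eqP.
    exact: (hG (existT _ X x)).
- pose z : Hcocycle M N n := MkHcocycle (@dHom0 M N n).
  have hz : Hclass z = 0.
    have : Hclass z = 1 *: Hclass z + Hclass z.
      apply: gen_lin; exists (hom0 M N (n - 1)) => X x.
      by rewrite dHom0 /= scaler0 !addr0.
    rewrite scale1r => /eqP; rewrite -subr_eq0 opprD addrA subrr sub0r oppr_eq0.
    by move/eqP.
  have -> : Hclass F = 0 *: Hclass z + Hclass F'.
    by apply: gen_lin; exists G => X x; rewrite scale0r add0r hG addrC.
  by rewrite scale0r add0r.
Qed.

(** * The Yoneda functor *)

Section Representable.
Variable Z : Ob.

Definition repr_space : gspaces K Ob := fun X => hom A X Z.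

Definition repr_op X (g : mword repr_space (hom A) X) n : repr_space X n :=
  let: MWord Y p x w := g in op (@pcons _ _ (hom A) X Y Z p x w) n.

Fact repr_op_deg X (g : mword repr_space (hom A) X) n :
  n != mdeg g + 2 - (mlen g)%:Z -> repr_op g n = 0.
Proof. by case: g => Y p x w /= h; apply: op_deg. Qed.

Fact repr_op_lin X c (g g1 g2 : mword repr_space (hom A) X) :
  mcomb c g g1 g2 -> forall n, repr_op g n = c *: repr_op g1 n + repr_op g2 n.
Proof.
case=> [Y p x1 x2 w|Y p x w w1 w2 h] n; apply: op_lin.
  exact: (@pcomb_here _ _ (hom A) c X Y Z p x1 x2).
exact: pcomb_there.
Qed.

Fact repr_eq X Y p (x : repr_space Y p) (w : path (hom A) X Y) n :
  splitsum w (fun C v t =>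
    sgn K (plen t)%:Z
    *: repr_op (MWord (repr_op (MWord x v) (p + pdeg v + 2 - (plen v).+1%:Z)) t)
         n)
  + splitsum w (fun C u r => splitsum r (fun D v t =>
    sgn K ((plen u).+1%:Z * (plen v)%:Z + (plen t)%:Z
           + (2 - (plen v)%:Z) * (p + pdeg u))
    *: repr_op
         (MWord x (pcat u (pcons (op v (pdeg v + 2 - (plen v)%:Z)) t))) n))
  = 0.
Proof.
rewrite -[RHS](ainf_eq (@pcons _ _ (hom A) X Y Z p x w) n) /=; congr (_ + _).
rewrite op0 op_letter0 scaler0 add0r; apply: splitsum_ext => C v t.
by rewrite mul0r add0r mulr0 addr0.
Qed.

Definition repr_polydule : polydule := Polydule repr_op_deg repr_op_lin repr_eq.

Fact repr_op2_id X p (x : repr_space X p) :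
  repr_op (MWord x (pcons (idm e X) (pnil X))) p = x.
Proof. exact: op2_idr. Qed.

Fact repr_op_id X (g : mword repr_space (hom A) X) n :
  (3 <= mlen g)%N ->
  (let: MWord _ _ _ w := g in has_unit (idm e) w) -> repr_op g n = 0.
Proof.
case: g => Y p x w /= hlen hw; apply: (op_id (s := e)).
  by rewrite /= eqn_leq negb_and -ltnNge hlen.
exact: (@has_unit_there _ X Y Z p x w hw).
Qed.

Definition representable : su_polydule :=
  @SUPolydule repr_polydule repr_op2_id repr_op_id.

End Representable.

(* The comodule map of degree [d] with components [c]. *)
Section Coextension.
Variables (M N : polydule) (d : int).
Variable c : forall X, mword (suspm (mspace M)) (suspq (hom A)) X ->
  forall n, suspm (mspace N) X n.
Hypothesis c_lin : forall X k g g1 g2, mcomb k g g1 g2 ->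
  forall n, @c X g n = k *: @c X g1 n + @c X g2 n.

Definition coext_word X (g : mword (suspm (mspace M)) (suspq (hom A)) X) :
    Bar N X :=
  let: MWord Y p x w := g in
  splitsum w (fun C v t =>
    bword (MWord (c (MWord x v) (p + pdeg v + d)) t)).

Fact coext_word_lin X k (g g1 g2 : mword (suspm (mspace M)) (suspq (hom A)) X) :
  mcomb k g g1 g2 -> coext_word g = k *: coext_word g1 + coext_word g2.
Proof.
case=> {g g1 g2} Y p.
- move=> x1 x2 w; apply: splitsum_comb => D v t.
  rewrite (c_lin (mcomb_head k x1 x2 v)).
  exact/cword_lin/mcomb_head.
- move=> x w w1 w2 h; apply: splitsum_lin h; split.
  + move=> l D v v1 v2 t hv.
    rewrite -!(pcomb_deg hv) (c_lin (mcomb_tail x hv)).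
    exact/cword_lin/mcomb_head.
  + by move=> l D v t t1 t2 ht; apply/cword_lin/mcomb_tail.
Qed.

Definition coext X : {linear Bar M X -> Bar N X} := lift (@coext_word_lin X).

End Coextension.

(* [yoneda phi] is the comodule map [Phi], for [phi] a nonempty word. *)
Section Yoneda.
Variables (X Y : Ob) (phi : path (suspq (hom A)) X Y).

Definition yoneda_comp B
    (g : mword (suspm (repr_space X)) (suspq (hom A)) B) n :
    suspm (repr_space Y) B n :=
  let: MWord C p x w := g in
  sgn K (pdeg phi)
  *: bop (pcat phi (@pcons _ _ (suspq (hom A)) B C X p x w)) n.

Fact yoneda_comp_lin B k g g1 g2 : mcomb k g g1 g2 ->
  forall n, @yoneda_comp B g n = k *: yoneda_comp g1 n + yoneda_comp g2 n.
Proof.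
case=> {g g1 g2} C p.
- move=> x1 x2 w n.
  have h := @pcomb_here _ _ (suspq (hom A)) k B C X p x1 x2 w.
  rewrite /yoneda_comp (bop_lin (pcomb_catr phi h)).
  by rewrite scalerDr !scalerA mulrC.
- move=> x w w1 w2 hw n.
  have h := @pcomb_there _ _ (suspq (hom A)) k B C X p x _ _ _ hw.
  rewrite /yoneda_comp (bop_lin (pcomb_catr phi h)).
  by rewrite scalerDr !scalerA mulrC.
Qed.

Definition yoneda B :
    {linear Bar (repr_polydule X) B -> Bar (repr_polydule Y) B} :=
  @coext (repr_polydule X) (repr_polydule Y) (pdeg phi + 1)
    yoneda_comp yoneda_comp_lin B.

End Yoneda.

(* [s f], of degree [n - 1]; the cast is along [n = n - 1 + 1]. *)
Definition suspend X Y n (f : hom A X Y n) : suspq (hom A) X Y (n - 1) :=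
  cast (n - 1 + 1) f.

(* [y_1 f = omega (Y_1 (s f)) = Phi] for [phi = s f]. *)
Definition yoneda1 X Y n (f : hom A X Y n) :=
  yoneda (pcons (suspend f) (pnil X)).

End AInfinity.

(* Main.v *)
From mathcomp Require Import all_boot all_order all_algebra.
From mathcomp Require Import ring.
Require Import Defs.

Set Implicit Arguments.
Unset Strict Implicit.
Unset Printing Implicit Defensive.

Import GRing.Theory.
Local Open Scope ring_scope.

(** The inverse of the Yoneda map on cohomology is evaluation at the unit: a
    map [F : X^ -> Y^] is sent to [ev F], which is [- F_1(s id_X)] with its
    suspension removed.

    One composite is the identity already on elements, because the only
    component of [y_1 f] that matters is [b_2(s f, s id) = +- s f]
    ([ev_yoneda]).  For the other one, inserting the unit in front of a word
    is a homotopy: let [H_i(x, w) = F_(i+1)(s id, x, w)] ([homotopy]).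
    Evaluate the component of [dF = 0] on a word [s id, x, w].  By strict
    unitality of the category, every operation whose first argument is [s id]
    vanishes, except [b_2(s id, x) = x], which contributes [F(x, w)].  The
    terms that do not apply [b] to the leading [s id] assemble to [dH], and
    the remaining term [b(F_1(s id), x, w)] is [y_1 (ev F)] up to sign.  So
    [F = y_1 (ev F) + d(+- H)] ([dcomp_homotopy], [homotopy_eq]).  The map [H]
    is strictly unital because an identity among its arguments from the
    category is also one among those of [F].

    These computations take place on components.  This is legitimate because
    a graded comodule map into a cofree comodule is the coextension of its
    corestriction ([hom_coext], which rests on [join_coact]), and because the
    differential of a coextension is again the coextension of an explicit
    family of components, [dcomp] ([bar_d_coext]): the terms in which the
    differential acts to the right of the component cancel.  That [y_1]
    commutes with the differentials up to sign ([dHom_yoneda]) is the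
    A-infinity relation of the category on words [s f, x, w], transported to
    the suspended operations, where the only sign left is the Koszul sign
    ([ainf_bar]). *)

(** * Sums over the ways of cutting a word *)

Section SplitSums.
Variables (K : fieldType) (Ob : Type) (Q : gquiver K Ob).

Lemma splitsum_morph (V W : zmodType) (f : V -> W) A B (w : path Q A B)
    (G : forall C, path Q C B -> path Q A C -> V) :
  {morph f : x y / x + y} ->
  f (splitsum w G) = splitsum w (fun C v t => f (G C v t)).
Proof.
by move=> fD; elim: w G => //= B' C' p a w IH G; rewrite fD IH.
Qed.

Lemma splitsum0 (V : zmodType) A B (w : path Q A B)
    (G : forall C, path Q C B -> path Q A C -> V) :
  (forall C v t, G C v t = 0) -> splitsum w G = 0.
Proof.
elim: w G => [|B' C' p a w IH] G h /=; first exact: h.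
by rewrite h IH ?addr0 // => D v t; apply: h.
Qed.

Lemma splitsumD (V : zmodType) A B (w : path Q A B)
    (G G' : forall C, path Q C B -> path Q A C -> V) :
  splitsum w (fun C v t => G C v t + G' C v t)
  = splitsum w G + splitsum w G'.
Proof. by elim: w G G' => //= B' C' p a w IH G G'; rewrite IH addrACA. Qed.

Lemma scale_splitsum (V : lmodType K) c A B (w : path Q A B)
    (G : forall C, path Q C B -> path Q A C -> V) :
  c *: splitsum w G = splitsum w (fun C v t => c *: G C v t).
Proof. by apply: splitsum_morph; apply: scalerDr. Qed.

Lemma splitsum_head (V : zmodType) A B (w : path Q A B)
    (G : forall C, path Q C B -> path Q A C -> V) :
  (forall C D p (a : Q D B p) (v : path Q C D) t, G C (pcons a v) t = 0) ->
  splitsum w G = G B (pnil B) w.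
Proof.
by case: w G => //= C D p a w G h; rewrite splitsum0 ?addr0 // => *; apply: h.
Qed.

(** Degrees of subwords only add up to the degree of the whole word when the
    subwords are known to concatenate to it. *)
Lemma splitsum_ext_cat (V : zmodType) A B (w : path Q A B)
    (G G' : forall C, path Q C B -> path Q A C -> V) :
  (forall C v t, pcat v t = w -> G C v t = G' C v t) ->
  splitsum w G = splitsum w G'.
Proof.
elim: w G G' => /= [|B' C' p a w IH] G G' h; first exact: h.
by rewrite h //; congr (_ + _); apply: IH => C v t E; apply: h; rewrite /= E.
Qed.

(** Coassociativity of deconcatenation: both sides sum over all ways of cutting
    a word into three. *)
Lemma splitsumA (V : zmodType) A B (w : path Q A B)
    (G : forall C D, path Q C B -> path Q D C -> path Q A D -> V) :
  splitsum w (fun C u r => splitsum r (fun D v t => G C D u v t))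
  = splitsum w (fun D s t => splitsum s (fun C u v => G C D u v t)).
Proof.
elim: w G => //= B' C' p a w IH G.
by rewrite splitsumD addrA IH.
Qed.

Lemma exchange_splitsum (V : zmodType) A B C D (u : path Q C D)
    (w : path Q A B)
    (G : forall E F, path Q E D -> path Q C E ->
           path Q F B -> path Q A F -> V) :
  splitsum u (fun E u1 u2 => splitsum w (fun F w1 w2 => G E F u1 u2 w1 w2))
  = splitsum w (fun F w1 w2 => splitsum u (fun E u1 u2 => G E F u1 u2 w1 w2)).
Proof. by elim: u G => //= B' C' p a u IH G; rewrite IH splitsumD. Qed.

(** The cut falls either to the left or to the right of the letter [a]. *)
Lemma splitsum_pcat (V : zmodType) A B B' C p (u : path Q B' C)
    (a : Q B B' p) (t : path Q A B)
    (G : forall D, path Q D C -> path Q A D -> V) :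
  splitsum (pcat u (pcons a t)) G
  = splitsum u (fun D u1 u2 => G D u1 (pcat u2 (pcons a t)))
    + splitsum t (fun D t1 t2 => G D (pcat u (pcons a t1)) t2).
Proof.
elim: u a G => //= B1 C1 q b u IH a G.
by rewrite IH addrA.
Qed.

Lemma pdeg_cat A B C (u : path Q B C) (w : path Q A B) :
  pdeg (pcat u w) = pdeg u + pdeg w.
Proof. by elim: u w => [|B' C' p a u IH] w /=; rewrite ?add0r ?IH ?addrA. Qed.

Lemma plen_cat A B C (u : path Q B C) (w : path Q A B) :
  plen (pcat u w) = (plen u + plen w)%N.
Proof. by elim: u w => [|B' C' p a u IH] w //=; rewrite IH. Qed.

Lemma omega_exp_cat A B C (u : path Q B C) (w : path Q A B) :
  omega_exp (pcat u w) = omega_exp u + (plen w)%:Z * pdeg u + omega_exp w.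
Proof.
elim: u w => [|B' C' p a u IH] w /=; first by rewrite mulr0 !add0r.
by rewrite IH plen_cat PoszD; ring.
Qed.

End SplitSums.

(** * Signs and homogeneous components *)

Section Signs.
Variable K : fieldType.

Lemma sgnD i j : sgn K (i + j) = sgn K i * sgn K j.
Proof. by rewrite /sgn expfzDr // oppr_eq0 oner_eq0. Qed.

Lemma sgn_double i : sgn K (i + i) = 1.
Proof. by rewrite sgnD /sgn -expfzMl mulrNN mulr1 exp1rz. Qed.

Lemma sgnMM i : sgn K i * sgn K i = 1.
Proof. by rewrite -sgnD sgn_double. Qed.

Lemma sgn_even k i j : i = j + (k + k) -> sgn K i = sgn K j.
Proof. by move->; rewrite sgnD sgn_double mulr1. Qed.

Lemma sgnS i : sgn K (i + 1) = - sgn K i.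
Proof. by rewrite sgnD /sgn expr1z mulrN1. Qed.

Lemma sgnB1 i : sgn K (-1 + i) = - sgn K i.
Proof. by rewrite sgnD [sgn K (-1)]/sgn exprN1 invrN1 mulN1r. Qed.

End Signs.

Section Cast.
Variables (K : fieldType) (V : int -> lmodType K).

Lemma cast_id p (x : V p) : cast p x = x.
Proof.
rewrite /cast; case: (p =P p) => // E.
by rewrite (eq_irrelevance E erefl).
Qed.

Lemma castK p q (x : V p) : p = q -> cast p (cast q x) = x.
Proof. by move=> E; subst q; rewrite !cast_id. Qed.

(** Operations are given in all degrees at once; [cast] between propositionally
    equal degrees of such a family disappears. *)
Lemma cast_family (x : forall p, V p) p q : p = q -> cast q (x p) = x q.
Proof. by move=> E; subst q; rewrite cast_id. Qed.

Lemma cast0 p q : cast q (0 : V p) = 0.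
Proof. by rewrite /cast; case: (p =P q) => // E; case: _ / E. Qed.

Lemma castD p q (x y : V p) : cast q (x + y) = cast q x + cast q y.
Proof. by rewrite -[x]scale1r cast_lin !scale1r. Qed.

Lemma castN p q (x : V p) : cast q (- x) = - cast q x.
Proof. by rewrite -[- x]addr0 -scaleN1r cast_lin cast0 addr0 scaleN1r. Qed.

End Cast.

(** * Comodule maps are determined by their corestrictions *)

Section Presentations.
Variables (K : fieldType) (X : Type) (lin : K -> X -> X -> X -> Prop).
Variable V : lmodType K.

Lemma lift_comb c (f f1 f2 : X -> V) hf hf1 hf2 :
  (forall x, f x = c *: f1 x + f2 x) -> forall u : pres lin,
  @lift _ _ lin V f hf u
  = c *: @lift _ _ lin V f1 hf1 u + @lift _ _ lin V f2 hf2 u.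
Proof.
move=> h; elim/pres_ind_gen => [x||k u v IHu IHv].
- by rewrite !lift_gen.
- by rewrite !linear0 addr0.
- rewrite [lift hf _]linearP [lift hf1 _]linearP [lift hf2 _]linearP IHu IHv.
  rewrite !scalerDr !scalerA [c * k]mulrC -!addrA.
  by congr (_ + _); rewrite addrCA.
Qed.

Lemma eq_linear_gen (f g : {linear pres lin -> V}) :
  (forall x, f (gen lin x) = g (gen lin x)) -> f =1 g.
Proof.
move=> h; elim/pres_ind_gen => [//||k u v IHu IHv]; first by rewrite !linear0.
by rewrite [f _]linearP [g _]linearP IHu IHv.
Qed.

End Presentations.

Section Evaluation.
Variables (K : fieldType) (Ob : Type).

Lemma cores_cword (M : gspaces K Ob) (Q : gquiver K Ob) X n (g : mword M Q X) :
  cores n (cword g) = cores_word n g.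
Proof. exact: lift_gen. Qed.

Lemma coact_cword (M : gspaces K Ob) (Q : gquiver K Ob) X (g : mword M Q X) :
  coact (cword g) = coact_word g.
Proof. exact: lift_gen. Qed.

Lemma tmapl_tens (I : Type) (V V' W : I -> lmodType K)
    (F : forall i, {linear V i -> V' i}) i (x : V i) (y : W i) :
  tmapl W F (tens x y) = tens (F i x) y.
Proof. exact: lift_gen. Qed.

Lemma bar_d_bword (A : ainf_category K Ob) (M : polydule A) X g :
  bar_d M X (bword g) = bar_d_word g.
Proof. exact: lift_gen. Qed.

Lemma coext_bword (A : ainf_category K Ob) (M N : polydule A) d c c_lin X g :
  @coext K Ob A M N d c c_lin X (bword g) = coext_word d c g.
Proof. exact: lift_gen. Qed.

End Evaluation.

(* Simplification must not unfold these maps: their values on words are given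
   by the lemmas above. *)
#[local] Opaque cores coact tmapl bar_d coext.

Section Reassembly.
Variables (K : fieldType) (Ob : Type) (M : gspaces K Ob) (Q : gquiver K Ob).
Variables (X : Ob) (m : int).

(** In total degree [m], [join] sends [z (x) t] to the word with head the
    corestriction of [z] and tail [t].  Fixing the total degree leaves only one
    degree [m - pdeg t] for the head, so no infinite sum over degrees occurs. *)
Definition join_word C (z : cofree M Q C) (t : path Q X C) : cofree M Q X :=
  cword (MWord (cores (m - pdeg t) z) t).

Fact join_word_lin C (z : cofree M Q C) c t t1 t2 : pcomb c t t1 t2 ->
  join_word z t = c *: join_word z t1 + join_word z t2.
Proof.
by move=> h; rewrite /join_word -!(pcomb_deg h); apply/cword_lin/mcomb_tail.
Qed.

Definition join_gen
    (u : {C : Ob & (cofree M Q C * Tc Q X C)%type}) : cofree M Q X :=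
  lift (join_word_lin (tagged u).1) (tagged u).2.

Fact join_lin c u u1 u2 : tlin c u u1 u2 ->
  join_gen u = c *: join_gen u1 + join_gen u2.
Proof.
case=> {u u1 u2} C => [z1 z2 t|z t1 t2]; last exact: linearP.
apply: (@lift_comb _ _ _ _ _ _ _ _ (join_word_lin _) (join_word_lin _)
          (join_word_lin _)) => w /=.
rewrite /join_word [cores _ _]linearP; exact/cword_lin/mcomb_head.
Qed.

Definition join : {linear cotensor M Q X -> cofree M Q X} := lift join_lin.

Lemma join_tens C (z : cofree M Q C) (t : path Q X C) :
  join (@tens K Ob (fun C => cofree M Q C) (fun C => Tc Q X C) C z (pword t))
  = join_word z t.
Proof. by rewrite [join _]lift_gen; apply: lift_gen. Qed.

Lemma cword0 C p (t : path Q X C) : cword (MWord (0 : M C p) t) = 0.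
Proof.
have := cword_lin (mcomb_head (-1) (0 : M C p) 0 t).
by rewrite scaler0 addr0 scaleN1r addNr.
Qed.

Lemma join_word_head C p (x : M C p) (t : path Q X C) :
  p + pdeg t = m -> join_word (cword (MWord x (pnil C))) t = cword (MWord x t).
Proof.
move=> E; rewrite /join_word -E addrK cores_cword /=.
by rewrite cast_id.
Qed.

(** Among all cuts of a word, only the one with left part of length one
    survives the corestriction, and it gives back the word. *)
Lemma join_coact (z : cofree M Q X) : homog m z -> join (coact z) = z.
Proof.
elim=> [g hg||c x y _ hx _ hy].
- rewrite coact_cword; case: g hg => Y p x w /= hm.
  rewrite (splitsum_morph (f := join)); last exact: linearD.
  case: w x hm => [|B C q a w] x hm /=.
    by rewrite join_tens join_word_head.
  rewrite join_tens join_word_head // splitsum0 ?addr0 // => D v t.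
  by rewrite join_tens /join_word cores_cword cword0.
- by rewrite !linear0.
- by rewrite [coact _]linearP linearP hx hy.
Qed.

End Reassembly.

(** * The differential of a coextension *)

Section ComoduleMaps.
Variables (K : fieldType) (Ob : Type) (A : ainf_category K Ob).

Lemma bword_head_lin (N : polydule A) X C p c
    (y z : suspm (mspace N) C p) (t : path (suspq (hom A)) X C) :
  bword (MWord (c *: y + z) t) = c *: bword (MWord y t) + bword (MWord z t).
Proof. exact/cword_lin/mcomb_head. Qed.

Lemma bword_headD (N : polydule A) X C p (t : path (suspq (hom A)) X C) :
  {morph (fun y : suspm (mspace N) C p => bword (MWord y t)) : y z / y + z}.
Proof. by move=> y z; rewrite -[y]scale1r bword_head_lin !scale1r. Qed.

Lemma bword_head_splitsum (N : polydule A) X B C D p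
    (t : path (suspq (hom A)) X C) (w : path (suspq (hom A)) B D)
    (G : forall E, path (suspq (hom A)) E D -> path (suspq (hom A)) B E ->
           suspm (mspace N) C p) :
  bword (MWord (splitsum w G) t)
  = splitsum w (fun E u v => bword (MWord (G E u v) t)).
Proof.
apply: (splitsum_morph (f := fun y => bword (MWord y t))).
exact: bword_headD.
Qed.

Lemma bword_head0 (N : polydule A) X C p (t : path (suspq (hom A)) X C) :
  bword (MWord (0 : suspm (mspace N) C p) t) = 0.
Proof. exact: cword0. Qed.

Lemma bword_headZ (N : polydule A) X C p c (t : path (suspq (hom A)) X C)
    (y : suspm (mspace N) C p) :
  bword (MWord (c *: y) t) = c *: bword (MWord y t).
Proof. by rewrite -[c *: y]addr0 bword_head_lin bword_head0 addr0. Qed.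

Lemma bword_head_sub (N : polydule A) X C p c
    (y z : suspm (mspace N) C p) (t : path (suspq (hom A)) X C) :
  bword (MWord (y - c *: z) t) = - c *: bword (MWord z t) + bword (MWord y t).
Proof. by rewrite -scaleNr addrC bword_head_lin. Qed.

Variables M N : polydule A.

Definition components := forall X,
  mword (suspm (mspace M)) (suspq (hom A)) X ->
  forall n, suspm (mspace N) X n.

Definition multilinear (c : components) :=
  forall X k g g1 g2, mcomb k g g1 g2 -> forall n,
   c X g n = k *: c X g1 n + c X g2 n.

(** Only the cut with empty right part gives a word of length one. *)
Lemma cores_coext_word d (c : components) X g n :
  cores n (coext_word d c g) = cast n (c X g (mdeg g + d)).
Proof.
case: g => Y p x w /=.
have H B (u : path (suspq (hom A)) X B)
    (q : forall C, path (suspq (hom A)) C B -> int)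
    (y : forall C v, suspm (mspace N) C (q C v)) :
  cores n (splitsum u (fun C v t => bword (MWord (y C v) t))) = cast n (y X u).
  elim: u q y => [|B' C q' a u IH] q y /=; first exact: cores_cword.
  rewrite [cores _ _]linearD [X in X + _]cores_cword /= add0r.
  exact: (IH _ (fun D v => y D (pcons a v))).
exact: (H _ w _ (fun C v => c C (MWord x v) (p + pdeg v + d))).
Qed.

Lemma eq_coext_word_comb d d1 d2 k (c c1 c2 : components) X
    (g : mword (suspm (mspace M)) (suspq (hom A)) X) : d = d1 -> d = d2 ->
  (forall Y (h : mword (suspm (mspace M)) (suspq (hom A)) Y),
     c Y h (mdeg h + d) = k *: c1 Y h (mdeg h + d) + c2 Y h (mdeg h + d)) ->
  coext_word d c g = k *: coext_word d1 c1 g + coext_word d2 c2 g.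
Proof.
move=> <- <- E; case: g => Y p x w; apply: splitsum_comb => C v t.
by rewrite (E _ (MWord x v)) bword_head_lin.
Qed.

Lemma eq_coext_word d d' (c c' : components) X
    (g : mword (suspm (mspace M)) (suspq (hom A)) X) : d = d' ->
  (forall Y (h : mword (suspm (mspace M)) (suspq (hom A)) Y),
     c Y h (mdeg h + d) = c' Y h (mdeg h + d)) ->
  coext_word d c g = coext_word d' c' g.
Proof.
move=> <- E; case: g => Y p x w; apply: splitsum_ext => C v t.
by rewrite (E _ (MWord x v)).
Qed.

Lemma bword_degE (N' : polydule A) X C (f : forall n, suspm (mspace N') C n) m n
  (t : path (suspq (hom A)) X C) : m = n ->
  bword (MWord (f m) t) = bword (MWord (f n) t).
Proof. by move->. Qed.

Lemma coext_comb d k (c c1 c2 : components) (c_lin : multilinear c)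
    (c1_lin : multilinear c1) (c2_lin : multilinear c2) X :
  (forall g : mword (suspm (mspace M)) (suspq (hom A)) X,
     coext_word d c g = k *: coext_word d c1 g + coext_word d c2 g) ->
  forall x, coext d c_lin X x = k *: coext d c1_lin X x + coext d c2_lin X x.
Proof.
move=> h.
apply: (@eq_linear_gen _ _ _ _ _
          ((k \*: coext d c1_lin X) \+ coext d c2_lin X)).
move=> g; rewrite -/(bword g) coext_bword h.
by rewrite -(coext_bword d c1_lin) -(coext_bword d c2_lin).
Qed.

(** The components of [b o F - (-1)^d F o b], for the map [F] of degree [d]
    with components [c]. *)
Definition dcomp d (c : components) : components :=
  fun X g m => let: MWord Y p x w := g in
  splitsum w (fun C v t => bmop (MWord (c C (MWord x v) (p + pdeg v + d)) t) m)
  - sgn K d *: (splitsum w (fun C v t =>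
                  c X (MWord (bmop (MWord x v) (p + pdeg v + 1)) t) m)
    + splitsum w (fun C u r => splitsum r (fun D v t =>
        sgn K (p + pdeg u)
        *: c X (MWord x (pcat u (pcons (bop v (pdeg v + 1)) t))) m))).

Section Coext.
Variables (d : int) (c : components) (c_lin : multilinear c).

Lemma coext_homog X n (x : Bar M X) :
  homog n x -> homog (n + d) (coext d c_lin X x).
Proof.
elim=> [g <-||k y z _ hy _ hz].
- rewrite coext_bword; case: g => Y p x0 w /=.
  have : forall G : forall C, path (suspq (hom A)) C Y ->
      path (suspq (hom A)) X C -> Bar N X,
      (forall C v t, pcat v t = w -> homog (p + pdeg w + d) (G C v t)) ->
      homog (p + pdeg w + d) (splitsum w G).
    move: (p + pdeg w + d) => m.
    elim: w => [|B C q a w IH] G h /=; first exact: h.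
    rewrite -[G _ _ _]scale1r; apply: homog_lin; first exact: h.
    by apply: IH => D v t E; apply: h; rewrite /= E.
  apply=> C v t <-; apply: homog_word.
  by rewrite /= pdeg_cat; ring.
- by rewrite linear0; apply: homog0.
- by rewrite linearP; apply: homog_lin.
Qed.

Lemma coext_comod X (x : Bar M X) :
  coact (coext d c_lin X x)
  = tmapl (fun C => Tc (suspq (hom A)) X C) (coext d c_lin) (coact x).
Proof.
suff E : (coact \o coext d c_lin X)
    =1 (tmapl (fun C => Tc (suspq (hom A)) X C) (coext d c_lin) \o coact).
  exact: E.
apply: eq_linear_gen => -[Y p x0 w] /=.
rewrite -/(bword (MWord x0 w)) coext_bword coact_cword /=.
rewrite (splitsum_morph (f := coact)); last exact: linearD.
rewrite (splitsum_morph (f := tmapl _ _)); last exact: linearD.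
under splitsum_ext do rewrite coact_cword /=.
rewrite splitsumA; apply: splitsum_ext => C v t.
rewrite tmapl_tens -/(bword (MWord x0 v)) coext_bword /=.
pose V C := cofree (suspm (mspace N)) (suspq (hom A)) C.
pose W C := Tc (suspq (hom A)) X C.
rewrite (splitsum_morph (f := fun z : V C => @tens K Ob V W C z (pword t))) //.
by move=> y z; rewrite -[y]scale1r tens_linl !scale1r.
Qed.

(** [S1] comes from [b o F] and [S2], [S3] from [F o b], where [b] meets the
    argument of the component.  [S4] collects the terms in which [b] acts
    further to the right; it occurs in both composites and cancels. *)
Lemma bar_d_coext X (g : mword (suspm (mspace M)) (suspq (hom A)) X) :
  bar_d N X (coext_word d c g) - sgn K d *: coext d c_lin X (bar_d_word g)
  = coext_word (d + 1) (dcomp d c) g.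
Proof.
case: g => Y p x w /=.
pose S1 := splitsum w (fun D s t => splitsum s (fun C v u =>
  bword (MWord (bmop (MWord (c (MWord x v) (p + pdeg v + d)) u)
    (p + pdeg s + (d + 1))) t))).
pose S2 := splitsum w (fun D s t => splitsum s (fun C v u =>
  bword (MWord (c (MWord (bmop (MWord x v) (p + pdeg v + 1)) u)
    (p + pdeg s + (d + 1))) t))).
pose S3 := splitsum w (fun D s t => splitsum s (fun C u r =>
  splitsum r (fun E v t1 => sgn K (p + pdeg u) *:
    bword (MWord (c (MWord x (pcat u (pcons (bop v (pdeg v + 1)) t1)))
      (p + pdeg s + (d + 1))) t)))).
pose S4 := splitsum w (fun D s r => splitsum r (fun C u q =>
  splitsum q (fun E v t => sgn K (p + pdeg s + pdeg u) *:
    bword (MWord (c (MWord x s) (p + pdeg s + d))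
                 (pcat u (pcons (bop v (pdeg v + 1)) t)))))).
have R : splitsum w (fun D s t => bword (MWord (dcomp d c (MWord x s)
      (p + pdeg s + (d + 1))) t)) = S1 - sgn K d *: (S2 + S3).
  rewrite /S1 /S2 /S3 -splitsumD -scaleNr [RHS]addrC.
  apply: splitsum_comb => D s t /=.
  rewrite bword_head_sub bword_headD.
  rewrite !bword_head_splitsum.
  congr (_ *: (_ + _) + _); apply: splitsum_ext => C u r.
  rewrite bword_head_splitsum.
  by apply: splitsum_ext => E v t1; rewrite bword_headZ.
have L1 : bar_d N X (splitsum w (fun C v t =>
    bword (MWord (c (MWord x v) (p + pdeg v + d)) t))) = S1 + sgn K d *: S4.
  rewrite (splitsum_morph (f := bar_d N X)); last exact: linearD.
  under splitsum_ext do rewrite bar_d_bword /=.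
  rewrite splitsumD; congr (_ + _).
    rewrite splitsumA; apply: splitsum_ext => D s t.
    apply: splitsum_ext_cat => C v u <-; apply: bword_degE.
    by rewrite pdeg_cat; ring.
  rewrite (scale_splitsum (sgn K d)).
  apply: splitsum_ext => D s r.
  rewrite (scale_splitsum (sgn K d)).
  apply: splitsum_ext => C u q.
  rewrite (scale_splitsum (sgn K d)).
  apply: splitsum_ext => E v t; rewrite scalerA -sgnD.
  by congr (sgn K _ *: _); ring.
have L2 : coext d c_lin X (splitsum w (fun C v t =>
      bword (MWord (bmop (MWord x v) (p + pdeg v + 1)) t))
    + splitsum w (fun C u r => splitsum r (fun D v t => sgn K (p + pdeg u)
        *: bword (MWord x (pcat u (pcons (bop v (pdeg v + 1)) t))))))
  = S2 + (S4 + S3).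
  rewrite [coext _ _ _ _]linearD; congr (_ + _).
    rewrite (splitsum_morph (f := coext d c_lin X)); last exact: linearD.
    under splitsum_ext do rewrite coext_bword /=.
    rewrite splitsumA; apply: splitsum_ext => D s t.
    apply: splitsum_ext_cat => C v u <-; apply: bword_degE.
    by rewrite pdeg_cat; ring.
  rewrite (splitsum_morph (f := coext d c_lin X)); last exact: linearD.
  under splitsum_ext => C u r.
    rewrite (splitsum_morph (f := coext d c_lin X)); last exact: linearD.
    under splitsum_ext => D v t.
      rewrite [coext _ _ _ _]linearZ /= coext_bword /= splitsum_pcat scalerDr.
      over.
    rewrite splitsumD; over.
  rewrite splitsumD; congr (_ + _).
    rewrite [RHS]splitsumA; apply: splitsum_ext => C u r.
    rewrite exchange_splitsum; apply: splitsum_ext => D v t.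
    rewrite (scale_splitsum (sgn K (p + pdeg u))).
    by apply: splitsum_ext_cat => E s u' <-; rewrite pdeg_cat addrA.
  have -> : S3 = splitsum w (fun D s t => splitsum s (fun C u r =>
    splitsum r (fun E v t1 => sgn K (p + pdeg u) *:
      bword (MWord (c (MWord x (pcat u (pcons (bop v (pdeg v + 1)) t1)))
        (p + pdeg (pcat u (pcons (bop v (pdeg v + 1)) t1)) + d)) t)))).
    apply: splitsum_ext => D s t; apply: splitsum_ext_cat => C u r Es.
    apply: splitsum_ext_cat => E v t1 Er; congr (_ *: _); apply: bword_degE.
    by rewrite -Es -Er !pdeg_cat /=; ring.
  rewrite -splitsumA; apply: splitsum_ext => C u r.
  rewrite -splitsumA; apply: splitsum_ext => D v t.
  by rewrite (scale_splitsum (sgn K (p + pdeg u))).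
by rewrite L1 L2 R addrCA scalerDr opprD addrA addrK.
Qed.

End Coext.
End ComoduleMaps.

(** * Morphisms of polydules through their components *)

Section HomComponents.
Variables (K : fieldType) (Ob : Type) (A : ainf_category K Ob).
Variables (e : strict_units A) (M N : su_polydule e).

Section Components.
Variables (d : int) (F : Hom M N d).

Definition comp : components M N := fun X g n => cores n (F X (bword g)).

Fact comp_lin : multilinear comp.
Proof.
by move=> X k g g1 g2 h n; rewrite /comp /bword (cword_lin h) !linearP.
Qed.

Lemma comp_head0 X C p (t : path (suspq (hom A)) X C) n :
  comp (MWord (0 : suspm (mspace M) C p) t) n = 0.
Proof. by rewrite /comp bword_head0 !linear0. Qed.

Lemma comp_letter0 X C D p q (x : suspm (mspace M) C q)
    (t : path (suspq (hom A)) X D) n :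
  comp (MWord x (pcons (0 : suspq (hom A) D C p) t)) n = 0.
Proof.
have := comp_lin
  (mcomb_tail x (pcomb_here (-1) (0 : suspq (hom A) D C p) 0 t)) n.
by rewrite scaler0 addr0 scaleN1r addNr.
Qed.

Lemma hom_coext X (x : Bar M X) : F X x = coext d comp_lin X x.
Proof.
move: x; apply: eq_linear_gen => -[Y p x w].
rewrite -/(bword (MWord x w)) coext_bword /=.
have hF : homog (p + pdeg w + d) (F X (bword (MWord x w))).
  by apply: hom_deg; apply: homog_word.
rewrite -(join_coact hF) hom_comod coact_cword /=.
rewrite (splitsum_morph (f := tmapl _ _)); last exact: linearD.
rewrite (splitsum_morph (f := join _ _ _ _)); last exact: linearD.
apply: splitsum_ext_cat => C v t E.
rewrite tmapl_tens join_tens /join_word -/(bword _); apply: bword_degE.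
by rewrite -E pdeg_cat; ring.
Qed.

Lemma dHom_bword (c : components M N) (c_lin : multilinear c) :
  (forall X x, F X x = coext d c_lin X x) ->
  forall X (g : mword (suspm (mspace M)) (suspq (hom A)) X),
  dHom F (bword g) = coext_word (d + 1) (dcomp d c) g.
Proof.
by move=> E X g; rewrite /dHom !E coext_bword bar_d_bword bar_d_coext.
Qed.

Lemma cocycle_comp X (g : mword (suspm (mspace M)) (suspq (hom A)) X) n :
  dHom F (bword g) = 0 -> n = mdeg g + (d + 1) -> dcomp d comp g n = 0.
Proof.
rewrite (dHom_bword hom_coext) => h ->.
by rewrite -[LHS]cast_id -cores_coext_word h linear0.
Qed.

End Components.

Lemma dHom_linP d (F : Hom M N d) X c x y :
  dHom F (c *: x + y) = c *: dHom F x + dHom (X := X) F y.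
Proof.
rewrite /dHom [F X (_ + _)]linearP [bar_d N X (_ + _)]linearP.
rewrite [bar_d M X (_ + _)]linearP [F X (_ + _)]linearP.
rewrite scalerBr !scalerDr opprD addrACA.
by rewrite !scalerA [c * _]mulrC.
Qed.

Lemma eq_dHom d (F : Hom M N d) X (f : {linear Bar M X -> Bar N X}) :
  (forall g, dHom F (bword g) = f (bword g)) -> forall x, dHom F x = f x.
Proof.
move=> h; elim/pres_ind_gen => [//||c x y IHx IHy].
- by rewrite /dHom !linear0 addr0.
- by rewrite dHom_linP linearP IHx IHy.
Qed.

(* The two degrees [d] and [d'] are propositionally equal: the Yoneda map comes
   with the degree [n - 1 + 0 + 1] where [n] is expected. *)
Section CoextHom.
Variables (d d' : int) (c : components M N) (c_lin : multilinear c).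
Hypothesis c_unital : forall X Y p (x : suspm (mspace M) Y p)
    (w : path (suspq (hom A)) X Y) n,
  has_unit (idm e) (pdesusp w) -> c (MWord x w) n = 0.
Hypothesis d_eq : d = d'.

Fact coext_hom_deg X n (x : Bar M X) :
  homog n x -> homog (n + d') (coext d c_lin X x).
Proof. by rewrite -d_eq; apply: coext_homog. Qed.

Fact coext_hom_unital X Y p (x : suspm (mspace M) Y p)
    (w : path (suspq (hom A)) X Y) n :
  has_unit (idm e) (pdesusp w) ->
  cores n (coext d c_lin X (bword (MWord x w))) = 0.
Proof.
move=> h; rewrite coext_bword cores_coext_word c_unital //.
exact: cast0.
Qed.

Definition coext_hom : Hom M N d' :=
  MkHom coext_hom_deg (coext_comod d c_lin) coext_hom_unital.

End CoextHom.
End HomComponents.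

(** * The A-infinity relation for the suspended operations *)

Section BarEquation.
Variables (K : fieldType) (Ob : Type) (A : ainf_category K Ob).

Lemma splitsum_pdesusp (V : zmodType) (Q : gquiver K Ob) X Y
    (w : path (suspq Q) X Y) (G : forall C, path Q C Y -> path Q X C -> V) :
  splitsum (pdesusp w) G
  = splitsum w (fun C u r => G C (pdesusp u) (pdesusp r)).
Proof. by elim: w G => //= B' C' p a w IH G; rewrite IH. Qed.

Lemma pdesusp_cat (Q : gquiver K Ob) X Y Z (u : path (suspq Q) Y Z)
    (w : path (suspq Q) X Y) :
  pdesusp (pcat u w) = pcat (pdesusp u) (pdesusp w).
Proof. by elim: u w => //= B C p a u IH w; rewrite IH. Qed.

Lemma plen_pdesusp (Q : gquiver K Ob) X Y (w : path (suspq Q) X Y) :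
  plen (pdesusp w) = plen w.
Proof. by elim: w => //= B C p a w ->. Qed.

Lemma pdeg_pdesusp (Q : gquiver K Ob) X Y (w : path (suspq Q) X Y) :
  pdeg (pdesusp w) = pdeg w + (plen w)%:Z.
Proof. by elim: w => //= B C p a w ->; rewrite -addn1 PoszD; ring. Qed.

Lemma op_letterZ X Y Z T p c (u : path (hom A) Z T) (a : hom A Y Z p)
    (t : path (hom A) X Y) n :
  op (pcat u (pcons (c *: a) t)) n = c *: op (pcat u (pcons a t)) n.
Proof.
have h k (a1 a2 : hom A Y Z p) := 
  op_lin (pcomb_catr u (pcomb_here k a1 a2 t)) n.
have h0 : op (pcat u (pcons (0 : hom A Y Z p) t)) n = 0.
  by have := h (-1) 0 0; rewrite scaler0 addr0 scaleN1r addNr.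
by rewrite -[c *: a]addr0 h h0 addr0.
Qed.

(** Suspension absorbs the signs of the A-infinity relation: for
    [b_k = - s m_k omega^(x)k] only the Koszul sign of moving [b], of degree 1,
    past the left part remains.  The sign of [omega^(x)n] on the whole word is
    a common factor. *)
Lemma ainf_bar X Y (w : path (suspq (hom A)) X Y) n :
  splitsum w (fun C u r => splitsum r (fun D v t => sgn K (pdeg u)
    *: bop (pcat u (pcons (bop v (pdeg v + 1)) t)) n)) = 0.
Proof.
transitivity (sgn K (omega_exp w) *: (0 : hom A X Y (n + 1))).
  2: exact: scaler0.
rewrite -(ainf_eq (pdesusp w) (n + 1)) splitsum_pdesusp.
rewrite (scale_splitsum (sgn K (omega_exp w))).
apply: splitsum_ext_cat => C u r Ew; rewrite splitsum_pdesusp.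
rewrite (scale_splitsum (sgn K (omega_exp w))).
apply: splitsum_ext_cat => D v t Er.
rewrite {1}/bop pdesusp_cat /= {2}/bop.
have -> : pdeg v + 1 + 1 = pdeg (pdesusp v) + 2 - (plen (pdesusp v))%:Z.
  by rewrite pdeg_pdesusp plen_pdesusp; ring.
rewrite -!scaleNr op_letterZ !scalerA -sgnS.
congr (_ *: _).
rewrite -Ew -Er !plen_pdesusp pdeg_pdesusp !omega_exp_cat /= !plen_cat /=.
(* The two exponents differ by [2 - 2 * plen u]. *)
rewrite -sgnS -!sgnD; apply: (@sgn_even _ (1 - (plen u)%:Z)).
by rewrite -addn1 !PoszD; ring.
Qed.
End BarEquation.

(** * The Yoneda map commutes with the differentials up to sign *)

Section Yoneda.
Variables (K : fieldType) (Ob : Type) (A : ainf_category K Ob).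

Lemma bop_nil X n : bop (pnil (Q := suspq (hom A)) X) n = 0.
Proof. by rewrite /bop op0 scaler0 oppr0. Qed.

Lemma bop_letter0 X Y Z T p (u : path (suspq (hom A)) Z T)
    (t : path (suspq (hom A)) X Y) n :
  bop (pcat u (pcons (0 : suspq (hom A) Y Z p) t)) n = 0.
Proof.
have := bop_lin
  (pcomb_catr u (pcomb_here (-1) (0 : suspq (hom A) Y Z p) 0 t)) n.
by rewrite scaler0 addr0 scaleN1r addNr.
Qed.

Lemma bop_letterZ X Y Z T p k (u : path (suspq (hom A)) Z T)
    (a : suspq (hom A) Y Z p) (t : path (suspq (hom A)) X Y) n :
  bop (pcat u (pcons (k *: a) t)) n = k *: bop (pcat u (pcons a t)) n.
Proof.
rewrite -[k *: a]addr0 (bop_lin (pcomb_catr u (pcomb_here k a 0 t))).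
by rewrite bop_letter0 addr0.
Qed.

Lemma bop1 X Y q (a : suspq (hom A) X Y q) n :
  bop (pcons a (pnil X)) n = - m1 (a : hom A X Y (q + 1)) (n + 1).
Proof. by rewrite /bop /= mul0r addr0 scale1r. Qed.

(** [ainf_bar] on [a, x, w], sorted by where the inner operation acts: on [a]
    alone, on a word starting with [a, x], on one starting with [x], or inside
    [w].  The terms with an empty inner word vanish. *)
Lemma ainf_bar2 B C X Y q p (a : suspq (hom A) X Y q) (x : suspq (hom A) C X p)
    (w : path (suspq (hom A)) B C) r n : r = q + 1 ->
  bop (pcons (bop (pcons a (pnil X)) r) (pcons x w)) n
  + splitsum w (fun D v t =>
      bop (pcons (bop (pcons a (pcons x v)) (q + (p + pdeg v) + 1)) t) n)
  + sgn K q *: (splitsum w (fun D v t =>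
      bop (pcons a (pcons (bop (pcons x v) (p + pdeg v + 1)) t)) n)
    + splitsum w (fun D u s => splitsum s (fun E v t => sgn K (p + pdeg u)
        *: bop (pcons a (pcons x (pcat u (pcons (bop v (pdeg v + 1)) t)))) n)))
  = 0.
Proof.
move=> ->; rewrite -[RHS](ainf_bar (pcons a (pcons x w)) n) /=.
rewrite !bop_nil (@bop_letter0 _ _ _ _ _ (pnil Y)).
rewrite (@bop_letter0 _ _ _ _ _ (pcons a (pnil X))).
rewrite !scaler0 !add0r addr0 !scale1r -addrA -!addrA.
congr (_ + (_ + _)); first by apply: splitsum_ext => D v t; rewrite scale1r.
rewrite scalerDr.
rewrite !(scale_splitsum (sgn K q)).
congr (_ + _).
apply: splitsum_ext => D u s.
rewrite !(scale_splitsum (sgn K q)).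
by apply: splitsum_ext => E v t; rewrite scalerA -sgnD.
Qed.

Lemma bmop_repr Z X C p (x : suspm (repr_space A Z) C p)
    (w : path (suspq (hom A)) X C) n :
  bmop (M := repr_polydule A Z) (MWord x w) n
  = bop (@pcons _ _ (suspq (hom A)) X C Z p x w) n.
Proof. by []. Qed.

Section YonedaMaps.
Variables (e : strict_units A) (X Y : Ob).

Definition yoneda_letter q (a : suspq (hom A) X Y q) :
    components (repr_polydule A X) (repr_polydule A Y) :=
  yoneda_comp (pcons a (pnil X)).

Fact yoneda_unital q (a : suspq (hom A) X Y q) B C p
    (x : suspm (repr_space A X) C p) (w : path (suspq (hom A)) B C) n :
  has_unit (idm e) (pdesusp w) -> yoneda_letter a (MWord x w) n = 0.
Proof.
move=> h; rewrite /yoneda_letter /= /bop.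
rewrite (op_id (s := e)) ?scaler0 ?oppr0 ?scaler0 //.
  have : (0 < plen (pdesusp w))%N by case: _ / h.
  by rewrite /=; case: plen.
by apply: has_unit_there; apply: has_unit_there.
Qed.

Definition yoneda_hom q d (a : suspq (hom A) X Y q) (E : q + 0 + 1 = d) :
    Hom (representable e X) (representable e Y) d :=
  coext_hom (M := representable e X) (N := representable e Y)
    (@yoneda_comp_lin _ _ _ _ _ (pcons a (pnil X))) (@yoneda_unital q a) E.

Lemma yoneda_lin q k (a a1 a2 : suspq (hom A) X Y q) B
    (x : Bar (repr_polydule A X) B) : a = k *: a1 + a2 ->
  yoneda (pcons a (pnil X)) B x
  = k *: yoneda (pcons a1 (pnil X)) B x + yoneda (pcons a2 (pnil X)) B x.
Proof.
move=> ->; apply: coext_comb => g.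
apply: eq_coext_word_comb => // C [D p y w] /=.
rewrite (bop_lin (pcomb_here k a1 a2 (@pcons _ _ (suspq (hom A)) C D X p y w))).
by rewrite scalerDr !scalerA mulrC.
Qed.

Lemma yoneda0 q B (x : Bar (repr_polydule A X) B) :
  yoneda (pcons (0 : suspq (hom A) X Y q) (pnil X)) B x = 0.
Proof.
rewrite (@yoneda_lin q (-1) 0 0 0) ?scaler0 ?addr0 //.
by rewrite scaleN1r addNr.
Qed.

(** The differential of the map given by [a] is the map given by [b_1 a]: in
    [ainf_bar2] the first term is opposite to the sum of the others, and these
    make up the components of the differential. *)
Lemma dcomp_yoneda q (a : suspq (hom A) X Y q) r B
    (g : mword (suspm (repr_space A X)) (suspq (hom A)) B) n : r = q + 1 ->
  dcomp (q + 0 + 1) (yoneda_letter a) g n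
  = yoneda_letter (bop (pcons a (pnil X)) r) g n.
Proof.
case: g => C p x w E.
have := ainf_bar2 a (x : suspq (hom A) C X p) w n E.
rewrite /yoneda_letter /= !addr0 E.
set T := bop _ n; set S1 := splitsum w _; set S2 := splitsum w _.
set S3 := splitsum w _ => h.
rewrite (_ : splitsum w _ = sgn K q *: S1); last first.
  rewrite (scale_splitsum (sgn K q)).
  apply: splitsum_ext => D v t; rewrite bmop_repr.
  rewrite (_ : p + pdeg v + (q + 1) = q + (p + pdeg v) + 1); last by ring.
  exact: (bop_letterZ _ (pnil Y)).
rewrite (_ : splitsum w _ = sgn K q *: S2); last first.
  by rewrite (scale_splitsum (sgn K q)).
rewrite (_ : splitsum w _ = sgn K q *: S3); last first.
  rewrite (scale_splitsum (sgn K q)).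
  apply: splitsum_ext => D u s.
  rewrite (scale_splitsum (sgn K q)).
  by apply: splitsum_ext => F v t; rewrite !scalerA mulrC.
move/eqP: h; rewrite -addrA addr_eq0 => /eqP ->.
by rewrite sgnS !scaleNr opprK scalerN opprK -scalerDr -scalerDr.
Qed.

Lemma dHom_yoneda q d (a : suspq (hom A) X Y q) (E : q + 0 + 1 = d) B
    (x : Bar (representable e X) B) :
  dHom (yoneda_hom a E) x
  = yoneda (pcons (bop (pcons a (pnil X)) d) (pnil X)) B x.
Proof.
move: x; apply: (@eq_dHom _ _ _ _ (representable e X) (representable e Y)) => g.
have Ed : d = q + 1 by rewrite -E; ring.
subst d.
rewrite (@dHom_bword _ _ _ _ (representable e X) (representable e Y) _ _
           (yoneda_letter a) (@yoneda_comp_lin _ _ _ _ _ _)) //.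
rewrite /yoneda coext_bword.
apply: eq_coext_word => [|C h]; first by rewrite /=; ring.
exact: dcomp_yoneda.
Qed.

End YonedaMaps.
End Yoneda.

(** * Evaluation at the unit and the contracting homotopy *)

Section UnitEvaluation.
Variables (K : fieldType) (Ob : Type) (A : ainf_category K Ob).
Variables (e : strict_units A) (X Y : Ob).
Local Notation RX := (representable e X).
Local Notation RY := (representable e Y).

(** The components of a map of representables and their arguments, typed in the
   spaces of morphisms, where the operations of the category apply. *)
Definition rcomp d (F : Hom RX RY d) B
    (g : mword (suspm (repr_space A X)) (suspq (hom A)) B) n :
    suspq (hom A) B Y n := comp F g n.

Lemma rcomp_head0 d (F : Hom RX RY d) B C p (t : path (suspq (hom A)) B C) n :
  rcomp F (MWord (0 : suspm (repr_space A X) C p) t) n = 0.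
Proof. exact: (comp_head0 F). Qed.

Lemma rcomp_letter0 d (F : Hom RX RY d) B C D p q
    (x : suspm (repr_space A X) C q) (t : path (suspq (hom A)) B D) n :
  rcomp F (MWord x (pcons (0 : suspq (hom A) D C p) t)) n = 0.
Proof. exact: (comp_letter0 F). Qed.

Definition rword B C p (x : suspq (hom A) C X p)
    (w : path (suspq (hom A)) B C) :
    mword (suspm (repr_space A X)) (suspq (hom A)) B :=
  @MWord _ _ (suspm (repr_space A X)) _ B C p x w.

Lemma dcomp_repr d (c : forall B, mword (suspm (repr_space A X))
      (suspq (hom A)) B -> forall n, suspq (hom A) B Y n)
    B C p (x : suspq (hom A) C X p) (w : path (suspq (hom A)) B C) n :
  dcomp (M := RX) (N := RY) d c (rword x w) n
  = splitsum w (fun D v t =>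
      bop (pcons (c D (rword x v) (p + pdeg v + d)) t) n)
    - sgn K d *: (splitsum w (fun D v t =>
        c B (rword (bop (pcons x v) (p + pdeg v + 1)) t) n)
      + splitsum w (fun D u r => splitsum r (fun E v t => sgn K (p + pdeg u)
        *: c B (rword x (pcat u (pcons (bop v (pdeg v + 1)) t))) n))).
Proof. by []. Qed.

Definition susp_id : suspm (repr_space A X) X (-1) := idm e X.

Definition unit_word : mword (suspm (repr_space A X)) (suspq (hom A)) X :=
  MWord susp_id (pnil X).

(** The sign makes [ev] a strict left inverse of the Yoneda map. *)
Definition ev d (F : Hom RX RY d) : hom A X Y d :=
  - cast d (rcomp F unit_word (d - 1) : hom A X Y (d - 1 + 1)).

Lemma m1_cast p q (f : hom A X Y p) n : p = q -> m1 (cast q f) n = m1 f n.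
Proof. by move=> E; subst q; rewrite cast_id. Qed.

(** [b_2(s f, s id) = - (-1)^(d - 1) s f], which cancels against the sign
    [(-1)^(d - 1)] in the definition of the Yoneda map and the one in [ev]. *)
Lemma ev_yoneda d (f : hom A X Y d) (E : d - 1 + 0 + 1 = d) :
  ev (yoneda_hom e (suspend f) E) = f.
Proof.
rewrite /ev /rcomp /comp [yoneda_hom _ _ _ _ _]/= coext_bword cores_coext_word.
rewrite cast_family /=; last by ring.
rewrite /bop /= (op2_idr e).
rewrite scalerN scalerA castN opprK mul1r mul0r !addr0 sgnMM scale1r.
by rewrite castK //; ring.
Qed.

Lemma suspend_ev d (F : Hom RX RY d) :
  suspend (ev F) = - (rcomp F unit_word (d - 1) : suspq (hom A) X Y (d - 1)).
Proof. by rewrite /suspend /ev castN castK //; ring. Qed.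

Lemma bop1_unit n :
  bop (@pcons _ _ (suspq (hom A)) X X X (-1) susp_id (pnil X)) n = 0.
Proof.
rewrite /bop (op_id (s := e)) ?scaler0 ?oppr0 //.
exact: (has_unit_here (idm e) (pnil X)).
Qed.

Lemma bop2_unit C p (x : suspq (hom A) C X p) n : n = p ->
  bop (@pcons _ _ (suspq (hom A)) C X X (-1) susp_id (pcons x (pnil C))) n
  = cast n x.
Proof.
move=> ->; rewrite cast_id /bop /= (op2_idl e) mul0r !addr0 mul1r.
by rewrite /sgn exprN1 invrN1 scaleN1r opprK.
Qed.

(** Since [b_1 (s id) = 0], the differential acts only on the value. *)
Lemma dcomp_unit d (F : Hom RX RY d) n :
  dcomp (M := RX) (N := RY) d (rcomp F) unit_word n
  = - m1 (rcomp F unit_word (-1 + 0 + d) : hom A X Y (-1 + 0 + d + 1)) (n + 1).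
Proof.
rewrite /unit_word dcomp_repr /= bop_nil rcomp_letter0 bop1_unit rcomp_head0.
by rewrite scaler0 !addr0 scaler0 subr0 bop1.
Qed.

(** The head [x] of the word, an element of the module [X^], is reread as a
    letter following the unit. *)
Definition homotopy_comp d (F : Hom RX RY d) : components RX RY :=
  fun B g n => let: MWord C p x w := g in
  rcomp F (MWord susp_id (@pcons _ _ (suspq (hom A)) B C X p x w)) n.

Fact homotopy_lin d (F : Hom RX RY d) : multilinear (homotopy_comp F).
Proof.
move=> B k g g1 g2 [C p x1 x2 w|C p x w w1 w2 h] n;
  apply: (comp_lin F); apply: mcomb_tail.
  exact: (@pcomb_here _ _ (suspq (hom A)) k B C X p).
exact: pcomb_there.
Qed.

Fact homotopy_unital d (F : Hom RX RY d) B C p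
    (x : suspm (mspace RX) C p) (w : path (suspq (hom A)) B C) n :
  has_unit (idm e) (pdesusp w) -> homotopy_comp F (MWord x w) n = 0.
Proof. by move=> h; apply: hom_unital; apply: has_unit_there. Qed.

Definition homotopy d (F : Hom RX RY d) : Hom RX RY (d - 1) :=
  coext_hom (@homotopy_lin d F) (@homotopy_unital d F) (erefl (d - 1)).

(** With [bop1_unit] and [bop2_unit], this determines all operations whose first
    argument is the unit. *)
Lemma bop_unit_long B C p (x : suspq (hom A) C X p) D q
    (b : suspq (hom A) D C q) (v : path (suspq (hom A)) B D) n :
  bop (@pcons _ _ (suspq (hom A)) B X X (-1) susp_id
         (pcons x (pcons b v))) n = 0.
Proof.
rewrite /bop (op_id (s := e)) ?scaler0 ?oppr0 //.
exact: (@has_unit_here _ _ _ (idm e) B X (pdesusp (pcons x (pcons b v)))).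
Qed.

(** The left-hand side vanishes when [F] is a cocycle.  In its expansion the
    inner operation is nonzero on a word starting with the unit only when that
    word is [s id, x], with value [x]; this gives the term [comp F g n]. *)
Lemma dcomp_homotopy d (F : Hom RX RY d) B
    (g : mword (suspm (repr_space A X)) (suspq (hom A)) B) n :
  (let: MWord C p x w := g in dcomp (M := RX) (N := RY) d (rcomp F)
    (MWord susp_id (@pcons _ _ (suspq (hom A)) B C X p x w)) n)
  = dcomp (d - 1) (homotopy_comp F) g n
    - sgn K d *: (rcomp F g n - yoneda_letter (suspend (ev F)) g n).
Proof.
case: g => C p x w.
rewrite 2!dcomp_repr /=.
rewrite !bop_nil !bop1_unit !rcomp_head0 !rcomp_letter0.
rewrite scaler0 !add0r suspend_ev.
pose S1 := splitsum w (fun D v t => bop (pcons (rcomp F (MWord susp_id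
  (@pcons _ _ (suspq (hom A)) D C X p x v)) (p + pdeg v + (d - 1))) t) n).
pose S2 := splitsum w (fun D v t => rcomp F (MWord susp_id
  (pcons (bop (@pcons _ _ (suspq (hom A)) D C X p x v) (p + pdeg v + 1)) t)) n).
pose S3 := splitsum w (fun D u s => splitsum s (fun E v t => sgn K (p + pdeg u)
  *: rcomp F (MWord susp_id (@pcons _ _ (suspq (hom A)) B C X p x
       (pcat u (pcons (bop v (pdeg v + 1)) t)))) n)).
rewrite -/S1 -/S2 -/S3.
rewrite (_ : splitsum w _ = S1); last first.
  apply: splitsum_ext => D v t.
  by rewrite (_ : p + pdeg v + (d - 1) = -1 + (p + pdeg v) + d) //; ring.
rewrite (_ : splitsum w _ = rcomp F (MWord x w) n); last first.
  rewrite splitsum_head => [|D E q b v t].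
    rewrite bop2_unit /=; last by ring.
    have E : -1 + (p + 0) + 1 = p by ring.
    by case: _ / (esym E); rewrite cast_id.
  by rewrite bop_unit_long rcomp_head0.
rewrite (_ : splitsum w _ = - S2); last first.
  rewrite (splitsum_morph (f := -%R)); last exact: opprD.
  by apply: splitsum_ext => D v t; rewrite sgnB1 scaleN1r.
rewrite (_ : splitsum w _ = - S3); last first.
  rewrite (splitsum_morph (f := -%R)); last exact: opprD.
  apply: splitsum_ext => D u s.
  rewrite (splitsum_morph (f := -%R)); last exact: opprD.
  by apply: splitsum_ext => E v t; rewrite sgnB1 scaleNr.
rewrite -(scaleN1r (rcomp F unit_word _)) (bop_letterZ _ (pnil Y)) /=.
rewrite !addr0 [d - 1]addrC !sgnB1 !scaleN1r scalerN !scaleNr !opprK.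
rewrite -opprD [_ + S1]addrC -!addrA; congr (_ + _).
by rewrite !scalerBr !opprB scalerA sgnMM scale1r addrCA.
Qed.
Lemma m1N p (f : hom A X Y p) n : m1 (- f) n = - m1 f n.
Proof.
have := m1_lin n (-1) f (0 : hom A X Y p).
by rewrite addr0 scaleN1r => ->; rewrite scaleN1r [m1 0 n]op_letter0 addr0.
Qed.

Lemma m1_ev d (F : Hom RX RY d) :
  (forall B (x : Bar RX B), dHom F x = 0) -> m1 (ev F) (d + 1) = 0.
Proof.
move=> h; rewrite /ev m1N m1_cast; last by ring.
have := dcomp_unit F d.
rewrite (_ : -1 + 0 + d = d - 1); last by ring.
rewrite -[- m1 _ _]/(- m1 _ _) => <-.
by apply: (cocycle_comp (F := F)); [apply: h | rewrite /=; ring].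
Qed.

Definition ev_primitive d (G : Hom RX RY d) : hom A X Y d :=
  cast d (rcomp G unit_word (d - 1) : hom A X Y (d - 1 + 1)).

(** [ev] is linear and turns the differential of [G] into a coboundary. *)
Lemma ev_comb d c (F F1 F2 : Hom RX RY d) (G : Hom RX RY (d - 1)) :
  (forall B (x : Bar RX B), F B x = c *: F1 B x + F2 B x + dHom G x) ->
  ev F = c *: ev F1 + ev F2 + m1 (ev_primitive G) d.
Proof.
move=> h.
have E : rcomp F unit_word (d - 1) = c *: rcomp F1 unit_word (d - 1)
    + rcomp F2 unit_word (d - 1)
    + dcomp (M := RX) (N := RY) (d - 1) (rcomp G) unit_word (d - 1).
  rewrite /rcomp /comp h [cores _ (_ + _)]linearD [cores _ (_ + F2 _ _)]linearP.
  congr (_ + _).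
  rewrite (dHom_bword (hom_coext G)) cores_coext_word cast_family //=; ring.
rewrite /ev E dcomp_unit castD castN cast_lin opprD opprK opprD scalerN.
congr (_ + _); rewrite cast_family; last by ring.
rewrite /ev_primitive m1_cast; last by ring.
by rewrite (_ : -1 + 0 + (d - 1) = d - 1 - 1) //; ring.
Qed.

Lemma homotopy_eq d (F : Hom RX RY d) (E : d - 1 + 0 + 1 = d) :
  (forall B (x : Bar RX B), dHom F x = 0) ->
  forall B (x : Bar RX B),
    F B x = dHom (hom_comb (sgn K d) (homotopy F) (hom0 RX RY (d - 1))) x
            + yoneda_hom e (suspend (ev F)) E B x.
Proof.
move=> hF B x.
pose F' := yoneda_hom e (suspend (ev F)) E.
suff h : dHom (hom_comb (sgn K d) (homotopy F) (hom0 RX RY (d - 1))) x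
         = (F B \- F' B) x by rewrite h /= subrK.
move: x; apply: eq_dHom => g.
rewrite (dHom_comb (c := sgn K d) (F := homotopy F)
           (G := hom0 RX RY (d - 1))) //.
rewrite dHom0 addr0 (dHom_bword (c_lin := homotopy_lin F)) //.
apply/eqP; rewrite eq_sym subr_eq; apply/eqP.
rewrite hom_coext coext_bword [F' B _]coext_bword.
apply: eq_coext_word_comb; [ring | by rewrite E | ] => C [D p y w].
have := dcomp_homotopy F (MWord y w) (mdeg (MWord y w) + d).
rewrite (cocycle_comp (F := F)) //; last by rewrite /=; ring.
move/esym/eqP; rewrite subr_eq0 => /eqP ->.
by rewrite scalerA sgnMM scale1r subrK.
Qed.

End UnitEvaluation.

Theorem mainTheorem15 (K : fieldType) (Ob : Type) (A : ainf_category K Ob)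
    (e : strict_units A) (X Y : Ob) (n : int) :
  exists h : {linear cohom A X Y n ->
                Hcohom (representable e X) (representable e Y) n},
    bijective h /\
    forall f : cocycle A X Y n,
      exists F : Hcocycle (representable e X) (representable e Y) n,
        (forall (B : Ob) (x : Bar (representable e X) B),
           F B x = yoneda1 f B x) /\
        h (cclass f) = Hclass F.
Proof.
have En : n - 1 + 0 + 1 = n by ring.
have dY (f : cocycle A X Y n) B (x : Bar (representable e X) B) :
    dHom (yoneda_hom e (suspend f) En) x = 0.
  rewrite dHom_yoneda bop1 /suspend m1_cast; last by ring.
  by rewrite cocycleP oppr0 yoneda0.
pose Yf f := MkHcocycle (dY f).
pose evF (F : Hcocycle (representable e X) (representable e Y) n) :=
  MkCocycle (m1_ev (HcocycleP F)).
have Yf_lin c (f f1 f2 : cocycle A X Y n) :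
    (exists g : hom A X Y (n - 1), (f : hom A X Y n)
      = c *: (f1 : hom A X Y n) + (f2 : hom A X Y n) + m1 g n) ->
    Hclass (Yf f) = c *: Hclass (Yf f1) + Hclass (Yf f2).
  case=> g Ef; apply: gen_lin.
  have Eg : n - 1 - 1 + 0 + 1 = n - 1 by ring.
  (* The term [y_1 (m1 g)] is the differential of [y_1 (- g)]. *)
  exists (yoneda_hom e (- suspend g) Eg) => B x; rewrite dHom_yoneda.
  pose b : suspq (hom A) X Y (n - 1) :=
    bop (pcons (- suspend g) (pnil X)) (n - 1).
  have Eb : b = cast (n - 1 + 1) (m1 g n).
    rewrite /b bop1 m1N opprK /suspend m1_cast; last by ring.
    by rewrite cast_family //; ring.
  rewrite (@yoneda_lin _ _ _ _ _ _ c (suspend f) (suspend f1) (suspend f2 + b)).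
    rewrite (@yoneda_lin _ _ _ _ _ _ 1 (suspend f2 + b) (suspend f2) b).
      by rewrite scale1r addrA.
    by rewrite scale1r.
  by rewrite Eb /suspend Ef castD cast_lin addrA.
have evF_lin c (F F1 F2 : Hcocycle (representable e X) (representable e Y) n) :
    (exists G : Hom (representable e X) (representable e Y) (n - 1),
      forall B (x : Bar (representable e X) B),
        F B x = c *: F1 B x + F2 B x + dHom G x) ->
    cclass (evF F) = c *: cclass (evF F1) + cclass (evF F2).
  case=> G hG; apply: gen_lin; exists (ev_primitive G) => /=.
  exact: ev_comb.
have hE f : lift Yf_lin (cclass f) = Hclass (Yf f) by exact: lift_gen.
have kE F : lift evF_lin (Hclass F) = cclass (evF F) by exact: lift_gen.
exists (lift Yf_lin); split; last by move=> f; exists (Yf f).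
exists (lift evF_lin); move=> u.
- suff h : lift evF_lin \o lift Yf_lin =1 idfun by exact: h.
  apply: eq_linear_gen => f; rewrite -/(cclass f) /= hE kE.
  by apply/cclassP; exists 0; rewrite [m1 0 n]op_letter0 add0r /= ev_yoneda.
- suff h : lift Yf_lin \o lift evF_lin =1 idfun by exact: h.
  apply: eq_linear_gen => F; rewrite -/(Hclass F) /= kE hE.
  apply/esym/HclassP.
  exists (hom_comb (sgn K n) (homotopy F) (hom0 _ _ (n - 1))) => B x.
  by apply: homotopy_eq; apply: HcocycleP.
Qed.
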